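(* Let $(\Sigma,g)$ be a smooth compact connected Riemannian surface with nonempty boundary $\partial\Sigma$, with Gaussian curvature $K\ge 0$ and with geodesic curvature $\kappa\ge 1$ on the boundary. Let $\lambda>0$ and $q\ge 2$ be constants, and let $u>0$ be a smooth function on $\Sigma$ satisfying $$\Delta u=0\ \text{ on }\Sigma,\qquad \frac{\partial u}{\partial\nu}+\lambda u=u^{q}\ \text{ on }\partial\Sigma.$$ If $\lambda\le\frac{1}{q-1}$, then $u$ is a constant function.
   Context: $\nu$ denotes the outer unit normal on $\partial\Sigma$. The geodesic curvature is $\kappa=\langle\nabla_{\partial_s}\nu,\partial_s\rangle$, where $\partial_s$ is a unit tangent vector to $\partial\Sigma$; with this sign convention the boundary of the Euclidean unit disc has $\kappa=1$. $\Delta$ is the Laplace–Beltrami operator. Smooth means smooth up to the boundary. *)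

(* Defs.v *)
From HB Require Import structures.
From mathcomp Require Import all_boot all_order all_algebra.
From mathcomp Require Import all_classical all_reals all_analysis.
Set Implicit Arguments.
Unset Strict Implicit.
Unset Printing Implicit Defensive.
Import Order.TTheory GRing.Theory Num.Theory.
Import numFieldNormedType.Exports.
Local Open Scope classical_set_scope.
Local Open Scope ring_scope.

Definition half_plane (R : realType) : set 'rV[R]_2 := [set x | 0 <= x 0 1].

Definition iter_partial (R : realType) (s : seq 'I_2) (F : 'rV[R]_2 -> R) :
    'rV[R]_2 -> R :=
  foldr (fun i G x => 'D_(delta_mx 0 i) G x) F s.

Definition smooth_on (R : realType) (U : set 'rV[R]_2) (F : 'rV[R]_2 -> R) :=
  forall (s : seq 'I_2) (x : 'rV[R]_2), U x ->
    (forall i, derivable (iter_partial s F) x (delta_mx 0 i)) /\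
    {for x, continuous (iter_partial s F)}.

(* For V relatively open in the half-plane: f extends, near each point of V,
   to a smooth function on an open subset of the plane. *)
Definition smooth_within (R : realType) (V : set 'rV[R]_2)
    (f : 'rV[R]_2 -> R) :=
  forall x, V x -> exists (U : set 'rV[R]_2) (F : 'rV[R]_2 -> R),
    [/\ open U, U x, smooth_on U F & forall y, U y -> V y -> F y = f y].

(* The partial derivative only uses values in the half-plane: it is the usual
   one at interior points, and one-sided in direction 1 on the edge, where it
   agrees with the partial derivative of any smooth extension. *)
Definition pd (R : realType) (i : 'I_2) (f : 'rV[R]_2 -> R)
    (x : 'rV[R]_2) : R :=
  lim (h^-1 * (f (x + h *: delta_mx 0 i) - f x)
       @[h --> within [set h : R | half_plane (x + h *: delta_mx 0 i)] 0^']).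

Record chart (R : realType) (T : topologicalType) := Chart {
  cdom : set T;
  cmap : T -> 'rV[R]_2;
  cinv : 'rV[R]_2 -> T }.

Definition cimg (R : realType) (T : topologicalType) (c : chart R T) :
    set 'rV[R]_2 := cmap c @` cdom c.

(* cmap is a homeomorphism from the open set cdom onto a relatively open subset
   of the half-plane, with inverse cinv; values elsewhere are irrelevant. *)
Definition is_chart (R : realType) (T : topologicalType) (c : chart R T) :=
  [/\ open (cdom c),
      exists2 U : set 'rV[R]_2, open U & cimg c = U `&` @half_plane R,
      forall p, cdom c p -> cinv c (cmap c p) = p,
      {within cdom c, continuous (cmap c)} &
      {within cimg c, continuous (cinv c)}].

Definition transition (R : realType) (T : topologicalType) (c d : chart R T)
    (j : 'I_2) (x : 'rV[R]_2) : R := cmap d (cinv c x) 0 j.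

(* Second countability is not required separately: it follows from the other
   axioms when T is compact. *)
Record smooth_surface (R : realType) (T : topologicalType) := SmoothSurface {
  atlas : set (chart R T);
  surface_hausdorff : hausdorff_space T;
  atlas_chart : forall c, atlas c -> is_chart c;
  atlas_cover : forall p : T, exists2 c, atlas c & cdom c p;
  atlas_smooth : forall c d, atlas c -> atlas d -> forall j,
    smooth_within (cmap c @` (cdom c `&` cdom d)) (transition c d j) }.

Definition surface_boundary (R : realType) (T : topologicalType)
    (S : smooth_surface R T) : set T :=
  [set p | exists c, [/\ atlas S c, cdom c p & cmap c p 0 1 = 0]].

Definition smooth_fun (R : realType) (T : topologicalType)
    (S : smooth_surface R T) (u : T -> R) :=
  forall c, atlas S c -> smooth_within (cimg c) (u \o cinv c).

(* [met c x] is the Gram matrix of the coordinate frame of c at the point with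
   coordinates x; the last axiom says that these are the components of one
   symmetric 2-tensor. *)
Record riemannian_metric (R : realType) (T : topologicalType)
    (S : smooth_surface R T) := RiemannianMetric {
  met : chart R T -> 'rV[R]_2 -> 'M[R]_2;
  met_smooth : forall c, atlas S c -> forall i j,
    smooth_within (cimg c) (fun x => met c x i j);
  met_sym : forall c x, atlas S c -> cimg c x -> (met c x)^T = met c x;
  met_pos : forall c x, atlas S c -> cimg c x ->
    forall v : 'rV[R]_2, v != 0 -> 0 < (v *m met c x *m v^T) 0 0;
  met_change : forall c d p, atlas S c -> atlas S d -> cdom c p -> cdom d p ->
    let J := \matrix_(i, j) pd i (transition c d j) (cmap c p) in
    met c (cmap c p) = J *m met d (cmap d p) *m J^T }.

(* Below, g is the Gram matrix of one chart as a function of the coordinates. *)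

Definition vfield (R : realType) := 'rV[R]_2 -> 'rV[R]_2.

Definition coord_field (R : realType) (i : 'I_2) : vfield R :=
  fun=> delta_mx 0 i.

Definition inner (R : realType) (g : 'rV[R]_2 -> 'M[R]_2) (X Y : vfield R)
    (x : 'rV[R]_2) : R := (X x *m g x *m (Y x)^T) 0 0.

(* The symbol with upper index k and lower indices i, j. *)
Definition christoffel (R : realType) (g : 'rV[R]_2 -> 'M[R]_2)
    (k i j : 'I_2) (x : 'rV[R]_2) : R :=
  2^-1 * \sum_(l < 2) invmx (g x) k l *
    (pd i (fun y => g y j l) x + pd j (fun y => g y i l) x
     - pd l (fun y => g y i j) x).

(* Levi-Civita covariant derivative of Y in the direction X. *)
Definition nabla (R : realType) (g : 'rV[R]_2 -> 'M[R]_2) (X Y : vfield R) :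
    vfield R :=
  fun x => \row_k \sum_(i < 2) X x 0 i *
    (pd i (fun y => Y y 0 k) x + \sum_(j < 2) christoffel g k i j x * Y x 0 j).

(* Coordinate fields commute, so the bracket term of the curvature tensor
   vanishes. *)
Definition gauss_curvature (R : realType) (g : 'rV[R]_2 -> 'M[R]_2)
    (x : 'rV[R]_2) : R :=
  let E0 := @coord_field R 0 in
  let E1 := @coord_field R 1 in
  inner g (nabla g E0 (nabla g E1 E1) \- nabla g E1 (nabla g E0 E1)) E0 x
  / \det (g x).

Definition grad (R : realType) (g : 'rV[R]_2 -> 'M[R]_2)
    (f : 'rV[R]_2 -> R) : vfield R :=
  fun x => (\row_j pd j f x) *m invmx (g x).

Definition divergence (R : realType) (g : 'rV[R]_2 -> 'M[R]_2)
    (X : vfield R) (x : 'rV[R]_2) : R :=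
  \sum_(i < 2) nabla g (@coord_field R i) X x 0 i.

Definition laplace_beltrami (R : realType) (g : 'rV[R]_2 -> 'M[R]_2)
    (f : 'rV[R]_2 -> R) : 'rV[R]_2 -> R := divergence g (grad g f).

Definition normalize (R : realType) (g : 'rV[R]_2 -> 'M[R]_2)
    (X : vfield R) : vfield R :=
  fun x => (Num.sqrt (inner g X X x))^-1 *: X x.

(* The edge is the zero set of the coordinate 1, which increases inwards. *)
Definition outer_normal (R : realType) (g : 'rV[R]_2 -> 'M[R]_2) : vfield R :=
  fun x => - normalize g (grad g (fun y => y 0 1)) x.

Definition unit_tangent (R : realType) (g : 'rV[R]_2 -> 'M[R]_2) : vfield R :=
  normalize g (@coord_field R 0).

(* For points x of the edge. The derivative of the normal is taken along the
   edge, so only its values on the edge matter. *)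
Definition geodesic_curvature (R : realType) (g : 'rV[R]_2 -> 'M[R]_2)
    (x : 'rV[R]_2) : R :=
  inner g (nabla g (unit_tangent g) (outer_normal g)) (unit_tangent g) x.

Definition normal_derivative (R : realType) (g : 'rV[R]_2 -> 'M[R]_2)
    (f : 'rV[R]_2 -> R) (x : 'rV[R]_2) : R :=
  \sum_(i < 2) outer_normal g x 0 i * pd i f x.

(* Main.v *)
Require Import Defs.
From HB Require Import structures.
From mathcomp Require Import all_boot all_order all_algebra.
From mathcomp Require Import all_classical all_reals all_analysis.
From mathcomp Require Import ring lra.
Import Order.TTheory GRing.Theory Num.Theory.
Import numFieldNormedType.Exports.
Local Open Scope classical_set_scope.
Local Open Scope ring_scope.

(* Let phi = |grad u|^2 / u^q.  On a surface a harmonic function satisfies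
   E (Delta E) - |grad E|^2 = 2 K E^2 with E = |grad u|^2, so that at a critical
   point of phi with E > 0 one has
   Delta phi = (2 K E + q E^2 / u^2) / u^q > 0, and phi has no local maximum
   there.  Hence the maximum of phi, if positive, is attained at a boundary
   point where the normal derivative of phi does not vanish, and is therefore
   positive.  But on the boundary E = h(u)^2 + u_s^2 with h(u) = u^q - lambda u,
   and the first and second order conditions for a tangential maximum give
   d phi / d nu <= 0, using kappa >= 1, (q - 1) lambda <= 1 and, when u_s = 0,
   q >= 2.  So phi = 0 and u is locally constant.  A boundary maximum with
   vanishing gradient is excluded by Delta phi > 0 and not by the Hopf lemma:
   there the Hessian of phi is nonpositive in every inward direction. *)

(** In dimension two the Hessian H of a harmonic function is trace-free, so H^2 is a multiple of the
    identity. This turns Bochner's formula into the identity for E, which says that Delta log E = 2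
    K where E > 0. As Delta log u = - E / u^2, the Laplacian of log phi is 2 K + q E / u^2: the
    denominator supplies strict positivity even where K = 0. The same exponent q fits the boundary
    condition, since h' - q h / u = (q - 1) lambda no longer depends on u and can be compared with
    kappa >= 1. The charts are arbitrary, without isothermal or Fermi coordinates, so the geometry
    is reduced to rational identities in the jet of the metric and of u, which [field] decides. Near
    an edge point these jets come from smooth extensions across the edge, and neither the equation
    nor the maximality is known on the far side. Hence every consequence of harmonicity or
    maximality is drawn from rays that stay in the half-plane. *)

Set Implicit Arguments.
Unset Strict Implicit.
Unset Printing Implicit Defensive.

(** * Calculus in the plane *)

Section Calculus.
Variable R : realType.
Notation P := 'rV[R]_2.
Implicit Types (F G : P -> R) (y z v : P) (p q s t : R) (i : 'I_2).

Lemma ord2_cases (i : 'I_2) : i = 0 \/ i = 1.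
Proof. by case: i => [[|[|]]] //= h; [left|right]; apply: val_inj. Qed.

Lemma sum2 (V : nmodType) (f : 'I_2 -> V) : \sum_(i < 2) f i = f 0 + f 1.
Proof. by rewrite big_ord_recl big_ord1; congr (f _ + f _); apply: val_inj. Qed.

Lemma row2P (v w : P) : v 0 0 = w 0 0 -> v 0 1 = w 0 1 -> v = w.
Proof. by move=> h0 h1; apply/rowP => i; case: (ord2_cases i) => ->. Qed.

Definition e_ i : P := delta_mx 0 i.

Lemma e_E i j : e_ i 0 j = (j == i)%:R.
Proof. by rewrite /e_ mxE eqxx. Qed.

Lemma row2_decomp v : v = v 0 0 *: e_ 0 + v 0 1 *: e_ 1.
Proof. by apply: row2P; rewrite !mxE /= ?mulr1 ?mulr0 ?addr0 ?add0r. Qed.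

Lemma norm_row2_le v s : 0 <= s -> (`|v| <= s) = (`|v 0 0| <= s) && (`|v 0 1| <= s).
Proof.
move=> s0; rewrite /Num.Def.normr /= mx_normrE.
apply/bigmax_leP/andP => [[_ h]|[h0 h1]].
  by split; [apply: (h (0,0))|apply: (h (0,1))].
by split=> // -[i j] _ /=; rewrite (ord1 i); case: (ord2_cases j) => ->.
Qed.

Lemma norm_coord_le v i : `|v 0 i| <= `|v|.
Proof.
have /andP[h0 h1] : (`|v 0 0| <= `|v|) && (`|v 0 1| <= `|v|).
  by rewrite -norm_row2_le.
by case: (ord2_cases i) => ->.
Qed.

Lemma derive_line F z v t (d : R) :
  is_derive (z + t *: v) v F d -> is_derive t 1 (fun h : R => F (z + h *: v)) d.
Proof.
move=> [dF <-].
have E : (fun h : R => h^-1 *: ((F \o shift (z + t *: v)) (h *: v) - F (z + t *: v)))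
  = (fun h => h^-1 *: (((fun h : R => F (z + h *: v)) \o shift t) (h *: 1) - F (z + t *: v))).
  apply/funext => h /=; congr (_ *: (F _ - _)).
  by rewrite scalerDl addrCA [_ *: (1:R)]mulr1 addrA addrC addrA addrC.
by split; [rewrite /derivable -E|rewrite /derive -E].
Qed.

Lemma mvt_line F (f : P -> R) z v s :
  (forall t, `|t| <= `|s| -> is_derive (z + t *: v) v F (f (z + t *: v))) ->
  exists2 c, `|c| <= `|s| & F (z + s *: v) - F z = s * f (z + c *: v).
Proof.
move=> h.
have cont a b : (forall t, t \in `[a, b]%R -> `|t| <= `|s|) ->
    {within `[a, b], continuous (fun h : R => F (z + h *: v))}.
  move=> ab; apply: derivable_within_continuous => t tab.
  by have := derive_line (h t (ab t tab)) => -[].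
have [s0|s0|->] := ltgtP s 0.
- have hb t : t \in `[s, 0]%R -> `|t| <= `|s|.
    by rewrite in_itv /= => /andP[? ?]; rewrite !ler0_norm ?lerN2 // ltW.
  have hd (t : R) : t \in `]s, 0[%R ->
      is_derive t 1 (fun h : R => F (z + h *: v)) (f (z + t *: v)).
    by move=> ts; exact: (derive_line (h t (hb t (subset_itv_oo_cc ts)))).
  have [c cs e] := MVT s0 hd (cont _ _ hb).
  exists c; first exact: (hb c (subset_itv_oo_cc cs)).
  by move: e; rewrite scale0r addr0 => e; rewrite -opprB e; ring.
- have hb t : t \in `[0, s]%R -> `|t| <= `|s|.
    by rewrite in_itv /= => /andP[? ?]; rewrite !ger0_norm // ltW.
  have hd (t : R) : t \in `]0, s[%R ->
      is_derive t 1 (fun h : R => F (z + h *: v)) (f (z + t *: v)).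
    by move=> ts; exact: (derive_line (h t (hb t (subset_itv_oo_cc ts)))).
  have [c cs e] := MVT s0 hd (cont _ _ hb).
  exists c; first exact: (hb c (subset_itv_oo_cc cs)).
  by move: e; rewrite scale0r addr0 subr0 => e; rewrite e mulrC.
- by exists 0 => //; rewrite scale0r addr0 subrr mul0r.
Qed.

(** * Differentiability with explicit gradients *)

Definition linf p q v : R := v 0 0 * p + v 0 1 * q.

Lemma linfD p q v w : linf p q (v + w) = linf p q v + linf p q w.
Proof. by rewrite /linf !mxE; ring. Qed.

Lemma linfZ p q t v : linf p q (t *: v) = t * linf p q v.
Proof. by rewrite /linf !mxE; ring. Qed.

(** The gradient is carried by its two components, so that it can be computed from the shape of an
    expression. *)
Definition has_grad F y p q := is_diff y F (linf p q).

Lemma is_diff_coord y i : is_diff y (fun v : P => v 0 i) (fun v => v 0 i).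
Proof.
have @f : {linear P -> R}.
  by exists (fun N : P => N 0 i); do 2![eexists]; do ?[constructor];
     rewrite ?mxE// => ? *; rewrite ?mxE//; move=> ?; rewrite !mxE.
have fc : continuous f by exact: coord_continuous.
rewrite (_ : (fun _ => _) = f) //; split; first exact/linear_differentiable.
by rewrite diff_lin.
Qed.

Lemma is_diff_linf y p q : is_diff y (linf p q) (linf p q).
Proof.
have h := is_diffD (is_diffZ p (is_diff_coord y 0)) (is_diffZ q (is_diff_coord y 1)).
have E : linf p q = p *: (fun v : P => v 0 0) + q *: (fun v : P => v 0 1).
  by apply/funext => v; rewrite /linf mulrC [X in _ + X]mulrC.
by rewrite E.
Qed.

Lemma is_diff0_eps (V W : normedModType R) (F : V -> W) (y : V) :
  (forall e : R, 0 < e -> exists2 d : R, 0 < d & forall v : V, `|v| < d ->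
     `|F (v + y) - F y| <= e * `|v|) -> is_diff y F (\0).
Proof.
move=> h.
have @z : {linear V -> W} := \0.
have E : F \o shift y = cst (F y) + z +o_ 0 id.
  apply/eqaddoP => e e0; have [d d0 hd] := h e e0.
  apply/nbhs_ballP; exists d => //= v; rewrite -ball_normE /= sub0r normrN => vd.
  by have := hd v vd; rewrite /= !fctE /= /cst addr0.
have zc : continuous z by exact: cst_continuous.
have Ed := diff_unique zc E.
by split=> //; apply/diff_locallyP; rewrite Ed.
Qed.

(** Subtracting the linear form reduces to a zero differential, where the little-o expansion is the
    estimate itself. *)
Lemma has_grad_eps F y p q :
  (forall e, 0 < e -> exists2 d, 0 < d & forall v, `|v| < d ->
     `|F (v + y) - F y - linf p q v| <= e * `|v|) -> has_grad F y p q.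
Proof.
move=> h.
have h1 : is_diff y (F - linf p q) (\0).
  apply: is_diff0_eps => e e0; have [d d0 hd] := h e e0; exists d => // v vd.
  have -> : (F - linf p q) (v + y) - (F - linf p q) y = F (v + y) - F y - linf p q v.
    by rewrite !fctE /linf !mxE; ring.
  exact: hd.
have h2 := is_diffD h1 (is_diff_linf y p q).
have EF : F - linf p q + linf p q = F by apply/funext => v; rewrite !fctE subrK.
have El : \0 + linf p q = linf p q by apply/funext => v; rewrite !fctE add0r.
by rewrite EF El in h2.
Qed.

Lemma is_diff_eps (V W : normedModType R) (F : V -> W) (df : V -> W) (y : V) :
  is_diff y F df ->
  forall e : R, 0 < e -> exists2 d : R, 0 < d & forall v : V, `|v| < d ->
     `|F (v + y) - F y - df v| <= e * `|v|.
Proof.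
move=> [/diff_locally + <-] e e0 => /eqaddoP /(_ e e0) /nbhs_ballP[d /= d0 hd].
exists d => // v vd; have := hd v; rewrite -ball_normE /= sub0r normrN => /(_ vd).
by rewrite !fctE /= /cst opprD addrA.
Qed.

Lemma has_grad_derive F y p q v : has_grad F y p q -> is_derive y v F (linf p q v).
Proof.
move=> [dF E]; split; first exact: diff_derivable.
by rewrite deriveE // E.
Qed.

(** The increment is split into two steps parallel to the axes. The mean value theorem applies to
    each, and continuity at y keeps each error within e / 2 times the norm of v. *)
Lemma has_grad_C1 F (f : 'I_2 -> P -> R) y :
  (forall i, \forall z \near y, is_derive z (e_ i) F (f i z)) ->
  (forall i, {for y, continuous (f i)}) -> has_grad F y (f 0 y) (f 1 y).
Proof.
move=> hf cf; apply: has_grad_eps => e e0.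
have e2 : 0 < e / 2 by lra.
have K i : exists2 d, 0 < d & forall z, `|z - y| < d ->
    is_derive z (e_ i) F (f i z) /\ `|f i z - f i y| <= e / 2.
  have /nbhs_ballP[d /= d0 hd] := hf i.
  have /cvgrPdist_le /(_ _ e2) /nbhs_ballP[d' /= d'0 hd'] := cf i.
  exists (Num.min d d'); first by rewrite lt_min d0.
  move=> z; rewrite lt_min => /andP[h1 h2]; split.
    by apply: hd; rewrite -ball_normE /= distrC.
  by rewrite distrC; apply: hd'; rewrite -ball_normE /= distrC.
have [d0 d00 h0] := K 0; have [d1 d10 h1] := K 1.
exists (Num.min d0 d1); first by rewrite lt_min d00.
move=> v; rewrite lt_min => /andP[v0 v1].
have b (s t : R) : `|s| <= `|v 0 0| -> `|t| <= `|v 0 1| ->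
    `|y + s *: e_ 0 + t *: e_ 1 - y| <= `|v|.
  move=> hs ht; rewrite norm_row2_le //; apply/andP; split;
  rewrite !mxE /= ?mulr1 ?mulr0 ?addr0.
    by rewrite addrAC subrr add0r; apply: le_trans hs (norm_coord_le _ _).
  by rewrite addrAC subrr add0r; apply: le_trans ht (norm_coord_le _ _).
have [|c hc Ec] := @mvt_line F (f 0) y (e_ 0) (v 0 0).
  move=> t ht; apply h0; apply: le_lt_trans v0.
  by have := b t 0 ht; rewrite scale0r addr0 normr0; apply.
have [|c' hc' Ec'] := @mvt_line F (f 1) (y + v 0 0 *: e_ 0) (e_ 1) (v 0 1).
  by move=> t ht; apply h1; apply: le_lt_trans v1; apply: b.
have -> : F (v + y) - F y - linf (f 0 y) (f 1 y) v =
   v 0 0 * (f 0 (y + c *: e_ 0) - f 0 y)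
   + v 0 1 * (f 1 (y + v 0 0 *: e_ 0 + c' *: e_ 1) - f 1 y).
  have -> : v + y = y + v 0 0 *: e_ 0 + v 0 1 *: e_ 1.
    by rewrite {1}(row2_decomp v) addrC addrA.
  by rewrite /linf; lra.
have i0 : `|f 0 (y + c *: e_ 0) - f 0 y| <= e / 2.
  apply h0; apply: le_lt_trans v0.
  by have := b c 0 hc; rewrite scale0r addr0 normr0; apply.
have i1 : `|f 1 (y + v 0 0 *: e_ 0 + c' *: e_ 1) - f 1 y| <= e / 2.
  by apply h1; apply: le_lt_trans v1; apply: b.
apply: le_trans (ler_normD _ _) _; rewrite !normrM.
have := ler_pM (normr_ge0 _) (normr_ge0 _) (norm_coord_le v 0) i0.
have := ler_pM (normr_ge0 _) (normr_ge0 _) (norm_coord_le v 1) i1.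
lra.
Qed.

(** Unlike [mvt_line], this asks for derivatives on one side only and gives a strictly positive c.
    It thus applies to segments that may not be continued across the edge. *)
Lemma mvt_ray F (f : P -> R) z v s : 0 < s ->
  (forall t, 0 <= t <= s -> is_derive (z + t *: v) v F (f (z + t *: v))) ->
  exists2 c, 0 < c < s & F (z + s *: v) - F z = s * f (z + c *: v).
Proof.
move=> s0 h.
have hd (t : R) : t \in `]0, s[%R ->
    is_derive t 1 (fun h : R => F (z + h *: v)) (f (z + t *: v)).
  by rewrite in_itv /= => /andP[a b]; apply/derive_line/h; rewrite !ltW.
have cont : {within `[0, s], continuous (fun h : R => F (z + h *: v))}.
  apply: derivable_within_continuous => t; rewrite in_itv /= => tab.
  by have := derive_line (h t tab) => -[].
have [c cs e] := MVT s0 hd cont.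
exists c; first by move: cs; rewrite in_itv.
by move: e; rewrite scale0r addr0 subr0 => e; rewrite e mulrC.
Qed.

Lemma has_grad_eq F y p q p' q' : has_grad F y p q -> p = p' -> q = q' -> has_grad F y p' q'.
Proof. by move=> ? <- <-. Qed.

Lemma has_grad_ext F G y p q : F =1 G -> has_grad F y p q -> has_grad G y p q.
Proof. by move=> /funext ->. Qed.

Lemma has_grad_near F G y p q d : 0 < d -> (forall z, `|z - y| < d -> F z = G z) ->
  has_grad F y p q -> has_grad G y p q.
Proof.
move=> d0 FG hF; apply: has_grad_eps => e e0.
have [d' d'0 h] := is_diff_eps hF e0.
exists (Num.min d d'); first by rewrite lt_min d0.
move=> v; rewrite lt_min => /andP[v1 v2].
rewrite -!FG ?addrK ?subrr ?normr0 //; exact: h.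
Qed.

Lemma is_diff_eq_fun (V W : normedModType R) (F : V -> W) (df df' : V -> W) (y : V) :
  is_diff y F df -> df =1 df' -> is_diff y F df'.
Proof. by move=> h /funext <-. Qed.

Lemma has_grad_cst (c : R) y : has_grad (fun=> c) y 0 0.
Proof.
by apply: is_diff_eq_fun (is_diff_cst _ _) _ => v; rewrite /linf !mulr0 addr0.
Qed.

Lemma has_gradD F G y p q p' q' : has_grad F y p q -> has_grad G y p' q' ->
  has_grad (fun z => F z + G z) y (p + p') (q + q').
Proof.
move=> hF hG; apply: is_diff_eq_fun (is_diffD hF hG) _ => v.
by rewrite !fctE /linf; ring.
Qed.

Lemma has_gradN F y p q : has_grad F y p q -> has_grad (fun z => - F z) y (- p) (- q).
Proof.
move=> hF; apply: is_diff_eq_fun (is_diffN hF) _ => v.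
by rewrite !fctE /linf; ring.
Qed.

Lemma has_gradM F G y p q p' q' : has_grad F y p q -> has_grad G y p' q' ->
  has_grad (fun z => F z * G z) y (p * G y + F y * p') (q * G y + F y * q').
Proof.
move=> hF hG; apply: is_diff_eq_fun (is_diffM hF hG) _ => v.
by rewrite !fctE /linf /GRing.scale /=; ring.
Qed.

Lemma has_grad_comp1 (f : R -> R) F y p q d : is_derive (F y) 1 f d -> has_grad F y p q ->
  has_grad (fun z => f (F z)) y (d * p) (d * q).
Proof.
move=> [/derivable1_diffP df df'] hF.
have hf : is_diff (F y) f (fun h => h * d).
  split=> //; apply/funext => h.
  by rewrite -df' deriveE // -{1}(mulr1 h) linearZ.
apply: is_diff_eq_fun (is_diff_comp hF hf) _ => v.
by rewrite /= /linf; ring.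
Qed.

Lemma has_gradV F y p q : F y != 0 -> has_grad F y p q ->
  has_grad (fun z => (F z)^-1) y (- p / F y ^+ 2) (- q / F y ^+ 2).
Proof.
move=> Fy hF; apply: has_grad_eq.
  apply: has_grad_comp1 hF.
  by apply: (is_deriveV Fy); apply: is_derive_id.
all: by rewrite /GRing.scale /=; field.
Qed.

Lemma has_grad_comp F (tau : P -> P) y p q a b c d : has_grad F (tau y) p q ->
  has_grad (fun z => tau z 0 0) y a b -> has_grad (fun z => tau z 0 1) y c d ->
  has_grad (fun z => F (tau z)) y (a * p + c * q) (b * p + d * q).
Proof.
move=> hF h0 h1.
have ht : is_diff y tau (fun v => linf a b v *: e_ 0 + linf c d v *: e_ 1).
  have E : (( *:%R ^~ (e_ 0)) \o (fun z => tau z 0 0))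
         + (( *:%R ^~ (e_ 1)) \o (fun z => tau z 0 1)) = tau.
    by apply/funext => z; rewrite !fctE /= -row2_decomp.
  have := is_diffD (is_diff_comp h0 (is_diff_scalel _ (e_ 0)))
     (is_diff_comp h1 (is_diff_scalel _ (e_ 1))).
  by rewrite E.
apply: is_diff_eq_fun (is_diff_comp ht hF) _ => v.
by rewrite /= /linf !mxE /= ; ring.
Qed.

(** Two-sided counterpart of [pd], meant for extensions on open sets of the plane; its iterates are
    those of [iter_partial]. *)
Definition par i F : P -> R := fun y => 'D_(e_ i) F y.

Lemma linf_e p q i : linf p q (e_ i) = if i == 0 then p else q.
Proof.
rewrite /linf !e_E; case: (ord2_cases i) => -> /=.
  by rewrite mul1r mul0r addr0.
by rewrite mul1r mul0r add0r.
Qed.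

Lemma has_grad_par F y p q : has_grad F y p q -> par 0 F y = p /\ par 1 F y = q.
Proof.
move=> h; split; have := has_grad_derive (e_ _) h => /(_ 0); rewrite /par.
  by move=> [_ ->]; rewrite linf_e.
by move=> _; have := has_grad_derive (e_ 1) h => -[_ ->]; rewrite linf_e.
Qed.

Lemma smooth_par (U : set P) i F : smooth_on U F -> smooth_on U (par i F).
Proof.
by move=> h s x Ux; have := h (rcons s i) x Ux; rewrite /iter_partial foldr_rcons.
Qed.

Lemma smooth_sub (U V : set P) F : V `<=` U -> smooth_on U F -> smooth_on V F.
Proof. by move=> VU h s x /VU; exact: h. Qed.

Lemma smooth_has_grad (U : set P) F y : open U -> smooth_on U F -> U y ->
  has_grad F y (par 0 F y) (par 1 F y).
Proof.
move=> oU sF Uy; apply: (@has_grad_C1 F (fun i => par i F)) => i.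
  have : nbhs y U by exact: open_nbhs_nbhs.
  apply: filterS => z Uz; apply: derivableP.
  by have [+ _] := sF [::] z Uz; apply.
by have [_] := sF [:: i] y Uy.
Qed.

Lemma derive_translate F z v w (d : R) :
  is_derive (z + w) v F d -> is_derive z v (fun z => F (z + w)) d.
Proof.
move=> [dF <-].
have E : (fun h : R => h^-1 *: ((F \o shift (z + w)) (h *: v) - F (z + w)))
  = (fun h => h^-1 *: (((fun z => F (z + w)) \o shift z) (h *: v) - F (z + w))).
  by apply/funext => h /=; rewrite addrA.
by split; [rewrite /derivable -E|rewrite /derive -E].
Qed.

Lemma open_ball (U : set P) y : open U -> U y ->
  exists2 d, 0 < d & forall z, `|z - y| < d -> U z.
Proof.
move=> oU Uy; have /nbhs_ballP[d /= d0 h] : nbhs y U by exact: open_nbhs_nbhs.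
by exists d => // z zy; apply: h; rewrite -ball_normE /= distrC.
Qed.

Lemma norm_e i : `|e_ i| <= 1.
Proof. by rewrite norm_row2_le // !e_E; case: (ord2_cases i) => -> /=; rewrite normr1 normr0 lexx ler01. Qed.

(** The mean value theorem for z |-> F (z + h e_j) - F z in direction i leaves a difference of
    values of the i-th partial derivative, which is expanded at y by differentiability. *)
Lemma second_difference (U : set P) F y i j : open U -> smooth_on U F -> U y ->
  forall e, 0 < e -> exists2 d, 0 < d & forall h, 0 < h < d ->
   `|F (y + h *: e_ i + h *: e_ j) - F (y + h *: e_ i) - F (y + h *: e_ j) + F y
     - h ^+ 2 * par j (par i F) y| <= e * h ^+ 2.
Proof.
move=> oU sF Uy e e0.
have hf := smooth_has_grad oU (smooth_par i sF) Uy.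
(* Two expansions are used, each at a displacement of norm at most 2 h, so the errors add up to 2 (e
   / 4) (2 h) = e h. *)
have e4 : 0 < e / 4 by lra.
have [d1 d10 h1] := is_diff_eps hf e4.
have [d2 d20 h2] := open_ball oU Uy.
exists (Num.min d1 d2 / 2); first by rewrite divr_gt0 // lt_min d10.
move=> h /andP[h0]; rewrite ltr_pdivlMr // lt_min => /andP[hd1 hd2].
have b (s t : R) : `|s| <= h -> `|t| <= h -> `|s *: e_ i + t *: e_ j| <= h * 2.
  move=> hs ht; apply: le_trans (ler_normD _ _) _; rewrite !normrZ.
  have := ler_pM (normr_ge0 _) (normr_ge0 _) hs (norm_e i).
  have := ler_pM (normr_ge0 _) (normr_ge0 _) ht (norm_e j).
  lra.
have inU (s t : R) : `|s| <= h -> `|t| <= h -> U (y + s *: e_ i + t *: e_ j).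
  move=> hs ht; apply: h2; rewrite -(addrA y) addrAC subrr add0r.
  exact: le_lt_trans (b _ _ hs ht) hd2.
have nh : `|h| = h by rewrite gtr0_norm.
have [|c hc Ec] := @mvt_line (fun z => F (z + h *: e_ j) - F z)
    (fun z => par i F (z + h *: e_ j) - par i F z) y (e_ i) h.
  move=> t; rewrite nh => ht; apply: is_deriveB.
    apply: derive_translate; have := smooth_has_grad oU sF (inU t h ht _).
    rewrite nh => /(_ (lexx _)) /(has_grad_derive (e_ i)); rewrite linf_e.
    by case: (ord2_cases i) => ->.
  have := smooth_has_grad oU sF (inU t 0 ht _); rewrite normr0 scale0r addr0.
  move=> /(_ (ltW h0)) /(has_grad_derive (e_ i)); rewrite linf_e.
  by case: (ord2_cases i) => ->.
rewrite nh in hc.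
have K1 := h1 (c *: e_ i + h *: e_ j); have K2 := h1 (c *: e_ i).
have B1 : `|c *: e_ i + h *: e_ j| <= h * 2 by apply: b; rewrite ?nh.
have B2 : `|c *: e_ i| <= h * 2.
  by have := b c 0 hc; rewrite normr0 scale0r addr0; apply; exact: ltW.
have {K1} := K1 (le_lt_trans B1 hd1).
have {K2} := K2 (le_lt_trans B2 hd1).
set l := linf _ _; rewrite [X in F (X + h *: e_ j)]addrC.
have ll : l (c *: e_ i + h *: e_ j) = l (c *: e_ i) + h * par j (par i F) y.
  rewrite /l linfD; congr (_ + _); rewrite linfZ linf_e.
  by case: (ord2_cases j) => ->.
rewrite ll.
have -> : c *: e_ i + h *: e_ j + y = y + c *: e_ i + h *: e_ j by rewrite addrC addrA.
rewrite (addrC _ y) (addrC _ y) => K2 K1.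
have -> : F (y + h *: e_ i + h *: e_ j) - F (y + h *: e_ i) - F (y + h *: e_ j) + F y
   = h * (par i F (y + c *: e_ i + h *: e_ j) - par i F (y + c *: e_ i)).
  by rewrite -Ec; ring.
set A := par i F _ in K1 *; set B := par i F _ in K2 *; set D := par j _ _ in K1 *.
have -> : h * (A - B) - h ^+ 2 * D = h * (A - B - h * D) by ring.
have -> : e * h ^+ 2 = h * (e * h) by ring.
rewrite normrM nh (ler_pM2l h0).
set C := par i F y in K1 K2.
have -> : A - B - h * D = (A - C - (l (c *: e_ i) + h * D)) - (B - C - l (c *: e_ i)).
  by ring.
apply: le_trans (ler_normB _ _) _.
have M1 : e / 4 * `|c *: e_ i + h *: e_ j| <= e / 4 * (h * 2) by rewrite ler_pM2l.
have M2 : e / 4 * `|c *: e_ i| <= e / 4 * (h * 2) by rewrite ler_pM2l.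
apply: le_trans (lerD K1 K2) _; apply: le_trans (lerD M1 M2) _.
by rewrite le_eqVlt; apply/orP; left; apply/eqP; field.
Qed.

Lemma second_difference_uniq (X Y Z W a A B e : R) : 0 < a ->
  `|X - Y - Z + W - a * A| <= e * a -> `|X - Z - Y + W - a * B| <= e * a ->
  `|A - B| <= 2 * e.
Proof.
move=> a0 K1 K2; rewrite -(ler_pM2l a0) -{1}(gtr0_norm a0) -normrM.
have -> : a * (A - B) = X - Z - Y + W - a * B - (X - Y - Z + W - a * A) by ring.
apply: le_trans (ler_normB _ _) _; apply: le_trans (lerD K2 K1) _.
by rewrite le_eqVlt; apply/orP; left; apply/eqP; ring.
Qed.

(** The second difference is symmetric in i and j, so both mixed derivatives are limits of the same
    quotient. *)
Lemma schwarz (U : set P) F y : open U -> smooth_on U F -> U y ->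
  par 1 (par 0 F) y = par 0 (par 1 F) y.
Proof.
move=> oU sF Uy; apply/eqP; rewrite -subr_eq0 -normr_le0 leNgt; apply/negP => D0.
set A := par 1 _ _ in D0; set B := par 0 _ _ in D0.
(* With this accuracy [second_difference_uniq] bounds the gap by half of itself. *)
have e0 : 0 < `|A - B| / 4 by rewrite divr_gt0.
have [d d0 hd] := @second_difference U F y 0 1 oU sF Uy _ e0.
have [d' d'0 hd'] := @second_difference U F y 1 0 oU sF Uy _ e0.
pose h := Num.min d d' / 2.
have m0 : 0 < Num.min d d' by rewrite lt_min d0.
have h0 : 0 < h by rewrite /h; lra.
have : h < Num.min d d' by rewrite /h; lra.
rewrite lt_min => /andP[h1 h2].
have := hd h; have := hd' h; rewrite h0 h1 h2 => /(_ isT) + /(_ isT).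
rewrite (addrAC y (h *: e_ 1)) -/A -/B.
move=> K1 K2; have hh : 0 < h ^+ 2 by rewrite exprn_gt0.
have := second_difference_uniq hh K2 K1.
by rewrite leNgt => /negP; apply; move: D0; clear; lra.
Qed.

(** * First and second order tests along rays *)

Lemma ray_gt F x v p q : has_grad F x p q -> 0 < linf p q v ->
  exists2 d, 0 < d & forall t, 0 < t < d -> F x < F (x + t *: v).
Proof.
move=> hF; set L := linf p q v => L0.
have v1 : 0 < `|v| + 1 by rewrite ltr_wpDl.
(* This makes the error at t v at most t L / 2, half of the linear gain; the summand 1 keeps the
   denominator positive. *)
have e0 : 0 < L / (2 * (`|v| + 1)) by rewrite divr_gt0 // mulr_gt0.
have [d' d'0 h] := is_diff_eps hF e0.
exists (d' / (`|v| + 1)); first by rewrite divr_gt0.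
move=> t /andP[t0]; rewrite ltr_pdivlMr // => td.
have tv0 : 0 <= t * `|v| by rewrite mulr_ge0 // ltW.
have tv : `|t *: v| < d' by rewrite normrZ gtr0_norm //; lra.
have := h _ tv; rewrite [t *: v + x]addrC.
have -> : linf p q (t *: v) = t * L by rewrite /L /linf !mxE; ring.
rewrite normrZ (gtr0_norm t0) ler_norml => /andP[k _].
have : L / (2 * (`|v| + 1)) * (t * `|v|) <= t * L / 2.
  have -> : t * L / 2 = L / (2 * (`|v| + 1)) * (t * (`|v| + 1)).
    by field; rewrite lt0r_neq0.
  by rewrite ler_pM2l // ler_pM2l // lerDl.
have : 0 < t * L by rewrite mulr_gt0.
lra.
Qed.

Lemma ray_le0 F x v p q d : 0 < d -> has_grad F x p q ->
  (forall t, 0 < t < d -> F (x + t *: v) <= F x) -> linf p q v <= 0.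
Proof.
move=> d0 hF hmax; rewrite leNgt; apply/negP => L0.
have [d' d'0 h] := ray_gt hF L0.
have m0 : 0 < Num.min d d' by rewrite lt_min d0.
have : Num.min d d' / 2 < Num.min d d' by lra.
rewrite lt_min => /andP[h1 h2].
have t0 : 0 < Num.min d d' / 2 by lra.
have := hmax _ (introT andP (conj t0 h1)).
by rewrite leNgt h // t0.
Qed.

(** Let M be the derivative of F along v. If M vanishes at x and has positive derivative along v,
    then M > 0 on a short ray, and by the mean value theorem F increases there. Equality of p1 and
    q0 is not presupposed, which is why only their sum occurs. *)
Lemma ray_le0_2 F (f0 f1 : P -> R) (U : set P) x v p0 p1 q0 q1 d : 0 < d ->
  open U -> U x -> (forall y, U y -> has_grad F y (f0 y) (f1 y)) ->
  has_grad f0 x p0 p1 -> has_grad f1 x q0 q1 -> linf (f0 x) (f1 x) v = 0 ->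
  (forall t, 0 < t < d -> F (x + t *: v) <= F x) ->
  v 0 0 * v 0 0 * p0 + v 0 0 * v 0 1 * (p1 + q0) + v 0 1 * v 0 1 * q1 <= 0.
Proof.
move=> d0 oU Ux hF h0 h1 M0 hmax; rewrite leNgt; apply/negP => m0.
pose M y := linf (f0 y) (f1 y) v.
have hM : has_grad M x (v 0 0 * p0 + v 0 1 * q0) (v 0 0 * p1 + v 0 1 * q1).
  apply: has_grad_eq; first by apply: has_gradD; apply: has_gradM;
    [exact: has_grad_cst|exact: h0|exact: has_grad_cst|exact: h1].
  by rewrite !mul0r !add0r.
  by rewrite !mul0r !add0r.
have [|d' d'0 hd'] := @ray_gt M x v _ _ hM; first by rewrite /linf; lra.
have v1 : 0 < `|v| + 1 by rewrite ltr_wpDl.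
have [d2 d20 inU] := open_ball oU Ux.
pose d3 := Num.min (Num.min d d') (d2 / (`|v| + 1)).
have d30 : 0 < d3 by rewrite !lt_min d0 d'0 divr_gt0.
have [s0 sd] : 0 < d3 / 2 /\ d3 / 2 < d3 by lra.
set s := d3 / 2 in s0 sd.
move: sd; rewrite !lt_min ltr_pdivlMr // => /andP[/andP[sd sd'] sd2].
have [|c /andP[c0 cs] Ec] := @mvt_ray F M x v s s0.
  move=> t /andP[t0 ts]; apply/has_grad_derive/hF/inU.
  rewrite addrAC subrr add0r normrZ ger0_norm //.
  have : t * `|v| <= s * `|v| by rewrite ler_wpM2r.
  lra.
have /(_ s) := hmax; rewrite s0 sd => /(_ isT).
have : M x < M (x + c *: v) by apply: hd'; rewrite c0 (lt_trans cs).
rewrite [M x]M0 => Mc; have := mulr_gt0 s0 Mc; rewrite -Ec; lra.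
Qed.

(** * One-sided partial derivatives and smooth extensions *)

Lemma half_plane_step x i t : @half_plane R x -> 0 <= t -> @half_plane R (x + t *: e_ i).
Proof.
by rewrite /half_plane /= !mxE => hx t0; rewrite addr_ge0 // mulr_ge0 // mxE //= ler0n.
Qed.

(** Small positive steps never leave the half-plane, so the limit in [pd] is taken along a proper
    filter and is unique, also on the edge. *)
Lemma proper_inward x i : half_plane x ->
  ProperFilter (within [set h : R | half_plane (x + h *: e_ i)] 0^').
Proof.
move=> Hx; apply: Build_ProperFilter_ex => A.
rewrite /within /= => /nbhs_ballP[d /= d0 hd].
have d2 : 0 < d / 2 by rewrite divr_gt0.
exists (d / 2); apply: hd.
- by rewrite -ball_normE /= sub0r normrN gtr0_norm // ltr_pdivrMr //; lra.
- by rewrite gt_eqF.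
- by apply: half_plane_step => //; exact: ltW.
Qed.

(** The two-sided limit for the extension F restricts to the filter of [pd], on which f and F
    agree. *)
Lemma pd_eq (U : set P) (f F : P -> R) y i : open U -> U y -> half_plane y ->
  (forall z, U z -> half_plane z -> f z = F z) ->
  forall p q, has_grad F y p q -> pd i f y = if i == 0 then p else q.
Proof.
move=> oU Uy Hy fF p q hF; rewrite -(linf_e p q i).
have [d d0 inU] := open_ball oU Uy.
have [dF <-] := has_grad_derive (e_ i) hF.
have PF := proper_inward i Hy.
apply: cvg_lim => //; apply: cvg_trans (cvg_within_filter _ dF).
apply: near_eq_cvg; rewrite /within /=; apply/nbhs_ballP; exists d => //= h.
rewrite -ball_normE /= sub0r normrN => hd _ Hh.
rewrite (addrC (h *: _)) !fF //; apply: inU.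
rewrite addrAC subrr add0r normrZ; apply: le_lt_trans hd.
by rewrite ler_piMr // norm_e.
Qed.
End Calculus.
Arguments e_ {R} i.

(** * Algebra of jets of a metric and a function *)

(* [ja], [jb], [jc] are the metric coefficients g_00, g_01, g_11 and [ju] the
   function; the digits list the coordinates of differentiation. *)
Record jet (R : Type) := Jet {
  ja : R; ja0 : R; ja1 : R; ja00 : R; ja01 : R; ja11 : R;
  jb : R; jb0 : R; jb1 : R; jb00 : R; jb01 : R; jb11 : R;
  jc : R; jc0 : R; jc1 : R; jc00 : R; jc01 : R; jc11 : R;
  ju : R; ju0 : R; ju1 : R; ju00 : R; ju01 : R; ju11 : R;
  ju000 : R; ju001 : R; ju011 : R; ju111 : R }.

Section JetAlgebra.
Variable R : realType.
Implicit Type j : jet R.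

Definition jdet j := ja j * jc j - jb j * jb j.
Definition jdet0 j := ja0 j * jc j + ja j * jc0 j - 2 * jb j * jb0 j.
Definition jdet1 j := ja1 j * jc j + ja j * jc1 j - 2 * jb j * jb1 j.
Definition jdet00 j := ja00 j * jc j + 2 * ja0 j * jc0 j + ja j * jc00 j
  - 2 * jb j * jb00 j - 2 * jb0 j * jb0 j.
Definition jdet01 j := ja01 j * jc j + ja0 j * jc1 j + ja1 j * jc0 j + ja j * jc01 j
  - 2 * jb j * jb01 j - 2 * jb0 j * jb1 j.
Definition jdet11 j := ja11 j * jc j + 2 * ja1 j * jc1 j + ja j * jc11 j
  - 2 * jb j * jb11 j - 2 * jb1 j * jb1 j.

(** The squared norm of du times the determinant: the inverse metric is replaced by the cofactor
    matrix, which avoids division. *)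
Definition jN j := jc j * ju0 j * ju0 j - 2 * jb j * ju0 j * ju1 j + ja j * ju1 j * ju1 j.
Definition jN0 j := jc0 j * ju0 j * ju0 j - 2 * jb0 j * ju0 j * ju1 j + ja0 j * ju1 j * ju1 j
  + 2 * jc j * ju0 j * ju00 j - 2 * jb j * (ju00 j * ju1 j + ju0 j * ju01 j)
  + 2 * ja j * ju1 j * ju01 j.
Definition jN1 j := jc1 j * ju0 j * ju0 j - 2 * jb1 j * ju0 j * ju1 j + ja1 j * ju1 j * ju1 j
  + 2 * jc j * ju0 j * ju01 j - 2 * jb j * (ju01 j * ju1 j + ju0 j * ju11 j)
  + 2 * ja j * ju1 j * ju11 j.
Definition jN00 j := jc00 j * ju0 j * ju0 j - 2 * jb00 j * ju0 j * ju1 j + ja00 j * ju1 j * ju1 j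
  + 2 * (2 * jc0 j * ju0 j * ju00 j - 2 * jb0 j * (ju00 j * ju1 j + ju0 j * ju01 j)
         + 2 * ja0 j * ju1 j * ju01 j)
  + 2 * jc j * (ju00 j * ju00 j + ju0 j * ju000 j)
  - 2 * jb j * (ju000 j * ju1 j + 2 * ju00 j * ju01 j + ju0 j * ju001 j)
  + 2 * ja j * (ju01 j * ju01 j + ju1 j * ju001 j).
Definition jN01 j := jc01 j * ju0 j * ju0 j - 2 * jb01 j * ju0 j * ju1 j + ja01 j * ju1 j * ju1 j
  + 2 * jc0 j * ju0 j * ju01 j - 2 * jb0 j * (ju01 j * ju1 j + ju0 j * ju11 j)
  + 2 * ja0 j * ju1 j * ju11 j
  + 2 * jc1 j * ju0 j * ju00 j - 2 * jb1 j * (ju00 j * ju1 j + ju0 j * ju01 j)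
  + 2 * ja1 j * ju1 j * ju01 j
  + 2 * jc j * (ju01 j * ju00 j + ju0 j * ju001 j)
  - 2 * jb j * (ju001 j * ju1 j + ju00 j * ju11 j + ju01 j * ju01 j + ju0 j * ju011 j)
  + 2 * ja j * (ju11 j * ju01 j + ju1 j * ju011 j).
Definition jN11 j := jc11 j * ju0 j * ju0 j - 2 * jb11 j * ju0 j * ju1 j + ja11 j * ju1 j * ju1 j
  + 2 * (2 * jc1 j * ju0 j * ju01 j - 2 * jb1 j * (ju01 j * ju1 j + ju0 j * ju11 j)
         + 2 * ja1 j * ju1 j * ju11 j)
  + 2 * jc j * (ju01 j * ju01 j + ju0 j * ju011 j)
  - 2 * jb j * (ju011 j * ju1 j + 2 * ju01 j * ju11 j + ju0 j * ju111 j)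
  + 2 * ja j * (ju11 j * ju11 j + ju1 j * ju111 j).

(* [jE] is |grad u|^2. *)
Definition jE j := jN j / jdet j.
Definition jE0 j := (jN0 j * jdet j - jN j * jdet0 j) / (jdet j * jdet j).
Definition jE1 j := (jN1 j * jdet j - jN j * jdet1 j) / (jdet j * jdet j).
Definition jE00 j := (jN00 j * jdet j * jdet j - 2 * jN0 j * jdet0 j * jdet j
  - jN j * jdet00 j * jdet j + 2 * jN j * jdet0 j * jdet0 j) / (jdet j * jdet j * jdet j).
Definition jE01 j := (jN01 j * jdet j * jdet j - jN0 j * jdet1 j * jdet j
  - jN1 j * jdet0 j * jdet j
  - jN j * jdet01 j * jdet j + 2 * jN j * jdet0 j * jdet1 j) / (jdet j * jdet j * jdet j).
Definition jE11 j := (jN11 j * jdet j * jdet j - 2 * jN1 j * jdet1 j * jdet j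
  - jN j * jdet11 j * jdet j + 2 * jN j * jdet1 j * jdet1 j) / (jdet j * jdet j * jdet j).

(* [jq0 / (2 det)] and [jq1 / (2 det)] are the contracted Christoffel symbols of
   the first kind, so that the Laplacian is [jL / (2 det^2)]. *)
Definition jq0 j := jc j * ja0 j - 2 * jb j * ja1 j + ja j * (2 * jb1 j - jc0 j).
Definition jq1 j := jc j * (2 * jb0 j - ja1 j) - 2 * jb j * jc0 j + ja j * jc1 j.
Definition jq00 j := jc0 j * ja0 j + jc j * ja00 j - 2 * jb0 j * ja1 j - 2 * jb j * ja01 j
  + ja0 j * (2 * jb1 j - jc0 j) + ja j * (2 * jb01 j - jc00 j).
Definition jq01 j := jc1 j * ja0 j + jc j * ja01 j - 2 * jb1 j * ja1 j - 2 * jb j * ja11 j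
  + ja1 j * (2 * jb1 j - jc0 j) + ja j * (2 * jb11 j - jc01 j).
Definition jq10 j := jc0 j * (2 * jb0 j - ja1 j) + jc j * (2 * jb00 j - ja01 j)
  - 2 * jb0 j * jc0 j - 2 * jb j * jc00 j + ja0 j * jc1 j + ja j * jc01 j.
Definition jq11 j := jc1 j * (2 * jb0 j - ja1 j) + jc j * (2 * jb01 j - ja11 j)
  - 2 * jb1 j * jc0 j - 2 * jb j * jc01 j + ja1 j * jc1 j + ja j * jc11 j.
(** Divided by [jdet], this is the trace of the matrix of second partial derivatives with respect to
    the metric. *)
Definition jH j := jc j * ju00 j - 2 * jb j * ju01 j + ja j * ju11 j.
Definition jH0 j := jc0 j * ju00 j - 2 * jb0 j * ju01 j + ja0 j * ju11 j
  + jc j * ju000 j - 2 * jb j * ju001 j + ja j * ju011 j.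
Definition jH1 j := jc1 j * ju00 j - 2 * jb1 j * ju01 j + ja1 j * ju11 j
  + jc j * ju001 j - 2 * jb j * ju011 j + ja j * ju111 j.
Definition jL j := 2 * jdet j * jH j
  - (jq0 j * (jc j * ju0 j - jb j * ju1 j) + jq1 j * (ja j * ju1 j - jb j * ju0 j)).
Definition jL0 j := 2 * jdet0 j * jH j + 2 * jdet j * jH0 j
  - (jq00 j * (jc j * ju0 j - jb j * ju1 j) + jq10 j * (ja j * ju1 j - jb j * ju0 j))
  - (jq0 j * (jc0 j * ju0 j + jc j * ju00 j - jb0 j * ju1 j - jb j * ju01 j)
     + jq1 j * (ja0 j * ju1 j + ja j * ju01 j - jb0 j * ju0 j - jb j * ju00 j)).
Definition jL1 j := 2 * jdet1 j * jH j + 2 * jdet j * jH1 j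
  - (jq01 j * (jc j * ju0 j - jb j * ju1 j) + jq11 j * (ja j * ju1 j - jb j * ju0 j))
  - (jq0 j * (jc1 j * ju0 j + jc j * ju01 j - jb1 j * ju1 j - jb j * ju11 j)
     + jq1 j * (ja1 j * ju1 j + ja j * ju11 j - jb1 j * ju0 j - jb j * ju01 j)).

(** With [ij,k] the Christoffel symbols of the first kind, K det g is - (a_11 - 2 b_01 + c_00) / 2
    plus the contraction of [01,k] [01,l] - [00,k] [11,l] with the inverse metric. *)
Definition jK j := (- (ja11 j - 2 * jb01 j + jc00 j) / 2
  + (jc j * ja1 j * ja1 j - 2 * jb j * ja1 j * jc0 j + ja j * jc0 j * jc0 j) / (4 * jdet j)
  - (jc j * ja0 j * (2 * jb1 j - jc0 j)
     - jb j * (ja0 j * jc1 j + (2 * jb0 j - ja1 j) * (2 * jb1 j - jc0 j))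
     + ja j * (2 * jb0 j - ja1 j) * jc1 j) / (4 * jdet j)) / jdet j.

(* The conclusion is the case [t = 0] of the identity
   E (Delta E) - |dE|^2 = 2 K E^2 + 2 E <du, dt> + 2 t (E t - <dE, du>), where
   [t] is the Laplacian of [u]; it holds for all jets and is proved as such. *)
Lemma bochner j : jdet j != 0 -> jL j = 0 -> jL0 j = 0 -> jL1 j = 0 ->
  jE j * (jc j * jE00 j - 2 * jb j * jE01 j + ja j * jE11 j) / jdet j
  - jE j * (jq0 j * (jc j * jE0 j - jb j * jE1 j) + jq1 j * (ja j * jE1 j - jb j * jE0 j))
    / (2 * jdet j * jdet j)
  - (jc j * jE0 j * jE0 j - 2 * jb j * jE0 j * jE1 j + ja j * jE1 j * jE1 j) / jdet j
  = 2 * jK j * jE j * jE j.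
Proof.
move=> D0 L L0 L1.
pose t := jL j / (2 * jdet j * jdet j).
pose t0 := (jL0 j * jdet j - 2 * jL j * jdet0 j) / (2 * jdet j * jdet j * jdet j).
pose t1 := (jL1 j * jdet j - 2 * jL j * jdet1 j) / (2 * jdet j * jdet j * jdet j).
have t_0 : t = 0 by rewrite /t L mul0r.
have t0_0 : t0 = 0 by rewrite /t0 L L0 !(mulr0, mul0r) subrr mul0r.
have t1_0 : t1 = 0 by rewrite /t1 L L1 !(mulr0, mul0r) subrr mul0r.
have -> : 2 * jK j * jE j * jE j = 2 * jK j * jE j * jE j
  + 2 * jE j * (jc j * ju0 j * t0 - jb j * (ju0 j * t1 + ju1 j * t0) + ja j * ju1 j * t1) / jdet j
  + 2 * t * (jE j * t
     - (jc j * jE0 j * ju0 j - jb j * (jE0 j * ju1 j + jE1 j * ju0 j)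
        + ja j * jE1 j * ju1 j) / jdet j).
  by rewrite t_0 t0_0 t1_0 !(mulr0, mul0r, addr0, subrr).
rewrite /t /t0 /t1 /jE /jE0 /jE1 /jE00 /jE01 /jE11 /jL /jL0 /jL1 /jK.
rewrite /jN /jN0 /jN1 /jN00 /jN01 /jN11 /jH /jH0 /jH1.
rewrite /jq0 /jq1 /jq00 /jq01 /jq10 /jq11 /jdet0 /jdet1 /jdet00 /jdet01 /jdet11.
rewrite /jdet in D0 *.
by field.
Qed.

(* [jX0 q j / u^q] is the first derivative of [|grad u|^2 / u^q]. *)
Definition jX0 q j := jE0 j - q * jE j * ju0 j / ju j.
Definition jX1 q j := jE1 j - q * jE j * ju1 j / ju j.
Definition jX00 q j := jE00 j - q * (jE0 j * ju0 j + jE j * ju00 j) / ju j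
  + q * jE j * ju0 j * ju0 j / (ju j * ju j).
(** Derivative of [jX0] in direction 1. It differs from [jX10] in general because [jX0] and [jX1]
    are u^q times partial derivatives of phi; only the sum of the two enters later. *)
Definition jX01 q j := jE01 j - q * (jE1 j * ju0 j + jE j * ju01 j) / ju j
  + q * jE j * ju0 j * ju1 j / (ju j * ju j).
Definition jX10 q j := jE01 j - q * (jE0 j * ju1 j + jE j * ju01 j) / ju j
  + q * jE j * ju0 j * ju1 j / (ju j * ju j).
Definition jX11 q j := jE11 j - q * (jE1 j * ju1 j + jE j * ju11 j) / ju j
  + q * jE j * ju1 j * ju1 j / (ju j * ju j).

(** The left side is u^q times the Laplacian of phi, whose first order terms vanish at a critical
    point. There dE = q E du / u, and substituting this into [bochner] gives E times the claim. *)
Lemma critical_laplacian q j : jdet j != 0 -> ju j != 0 -> jE j != 0 ->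
  jL j = 0 -> jL0 j = 0 -> jL1 j = 0 -> jX0 q j = 0 -> jX1 q j = 0 ->
  (jc j * jX00 q j - jb j * (jX01 q j + jX10 q j) + ja j * jX11 q j) / jdet j
  = 2 * jK j * jE j + q * jE j * jE j / (ju j * ju j).
Proof.
move=> D0 u0 E0 L L0 L1 X0 X1; have B := bochner D0 L L0 L1.
have H0 : jE0 j = q * jE j * ju0 j / ju j by apply/eqP; rewrite -subr_eq0 -/(jX0 q j) X0.
have H1 : jE1 j = q * jE j * ju1 j / ju j by apply/eqP; rewrite -subr_eq0 -/(jX1 q j) X1.
have HN : jE j = (jc j * ju0 j * ju0 j - 2 * jb j * ju0 j * ju1 j + ja j * ju1 j * ju1 j) / jdet j by [].
(* Harmonicity trades the contracted Christoffel terms for the trace of the second derivatives. *)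
have W : jq0 j * (jc j * ju0 j - jb j * ju1 j) + jq1 j * (ja j * ju1 j - jb j * ju0 j)
   = 2 * jdet j * (jc j * ju00 j - 2 * jb j * ju01 j + ja j * ju11 j).
  by apply/esym/eqP; rewrite -subr_eq0; apply/eqP; exact: L.
rewrite /jX00 /jX01 /jX10 /jX11.
move: B; rewrite H0 H1.
have -> : jq0 j * (jc j * (q * jE j * ju0 j / ju j) - jb j * (q * jE j * ju1 j / ju j)) +
   jq1 j * (ja j * (q * jE j * ju1 j / ju j) - jb j * (q * jE j * ju0 j / ju j))
   = q * jE j / ju j * (2 * jdet j * (jc j * ju00 j - 2 * jb j * ju01 j + ja j * ju11 j)).
  by rewrite -W; field.
have -> : (jc j * (q * jE j * ju0 j / ju j) * (q * jE j * ju0 j / ju j) -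
   2 * jb j * (q * jE j * ju0 j / ju j) * (q * jE j * ju1 j / ju j) +
   ja j * (q * jE j * ju1 j / ju j) * (q * jE j * ju1 j / ju j)) / jdet j
   = (q * jE j / ju j) * (q * jE j / ju j) * jE j.
  by rewrite [in X in _ = _ * X]HN; field; rewrite u0 D0.
move: HN E0; move: (jE j) (jE00 j) (jE01 j) (jE11 j) (jK j) => E E00 E01 E11 K HN E0 B.
apply: (mulfI E0).
have -> : E * (2 * K * E + q * E * E / (ju j * ju j))
  = 2 * K * E * E + q * E * E * E / (ju j * ju j) by field.
by rewrite -B HN; field; rewrite u0 D0.
Qed.

(* Outer normal derivative and geodesic curvature in terms of
   [jsig = sqrt (g^11)]; the outer normal is [jsig * (b / a, -1)]. *)
Definition jsig j := Num.sqrt (ja j / jdet j).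
Definition jnu j := jsig j * (jb j / ja j * ju0 j - ju1 j).
Definition jkap j := jsig j / ja j * (jb0 j - ja1 j / 2 - ja0 j * jb j / (2 * ja j)).

(** With nu the normal and s arc length, dE/dnu = 2 (u_nu Hess(nu,nu) + u_s Hess(s,nu)). Harmonicity
    gives Hess(nu,nu) = - Hess(s,s) = - (u_ss + kappa u_nu), and differentiating u_nu = h along the
    edge gives Hess(s,nu) = (h' - kappa) u_s. In the statement [s] stands for [jsig], [s0] for its
    derivative along the edge, and u_ss is written out in the coordinate. *)
Lemma boundary_identity j (s s0 h h' : R) :
  ja j != 0 -> jdet j != 0 -> s != 0 -> s * s * jdet j = ja j ->
  2 * s * s0 * jdet j * jdet j = ja0 j * jdet j - ja j * jdet0 j ->
  jL j = 0 ->
  s * (jb j / ja j * ju0 j - ju1 j) = h ->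
  s0 * (jb j / ja j * ju0 j - ju1 j)
   + s * ((jb0 j * ja j - jb j * ja0 j) / (ja j * ja j) * ju0 j + jb j / ja j * ju00 j - ju01 j)
   = h' * ju0 j ->
  s * (jb j / ja j * jE0 j - jE1 j) =
  2 * (- (s / ja j * (jb0 j - ja1 j / 2 - ja0 j * jb j / (2 * ja j))) * jE j
       - h * (ju00 j / ja j - ju0 j * ja0 j / (2 * ja j * ja j))
       + h' * ju0 j * ju0 j / ja j)
  /\ jE j = h * h + ju0 j * ju0 j / ja j.
Proof.
case: j => a a0 a1 a00 a01 a11 b b0 b1 b00 b01 b11 c c0 c1 c00 c01 c11 u u0 u1 u00 u01 u11 ? ? ? ?.
rewrite /jE /jE0 /jE1 /jN /jN0 /jN1 /jL /jH /jq0 /jq1 /jdet0 /jdet1 /jdet /=.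
move=> an Dn sn s2 s02 L nu nu0.
(* The hypotheses are solved in turn for c, c0, u1, u01 and u11; after this elimination both claims
   are rational identities. *)
have Ec : c = (a / (s * s) + b * b) / a.
  by rewrite -{1}s2; field; rewrite sn an.
have Du : a * c - b * b = a / (s * s) by rewrite Ec; field; rewrite an sn.
have Ec0 : c0 = ((a0 - 2 * s0 * a / s) / (s * s) + 2 * b * b0 - a0 * c) / a.
  have -> : (a0 - 2 * s0 * a / s) / (s * s)
     = (a0 * (a / (s * s)) - 2 * s * s0 * (a / (s * s)) * (a / (s * s))) / a.
    by field; rewrite an sn.
  by rewrite -Du s02; field.
have Eu1 : u1 = b / a * u0 - h / s by rewrite -nu; field; rewrite an sn.
have Eu01 : u01 = s0 * (h / s) / s + (b0 * a - b * a0) / (a * a) * u0 + b / a * u00 - h' * u0 / s.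
  by rewrite -nu0 Eu1; field; rewrite an sn.
have Eu11 : u11 = ((c * a0 - 2 * b * a1 + a * (2 * b1 - c0)) * (c * u0 - b * u1) +
     (c * (2 * b0 - a1) - 2 * b * c0 + a * c1) * (a * u1 - b * u0))
     / (2 * (a * c - b * b) * a) - (c * u00 - 2 * b * u01) / a.
  apply/eqP; rewrite -subr_eq0; apply/eqP.
  rewrite -(mul0r (2 * (a * c - b * b) * a)^-1) -L; field.
  by rewrite an Dn.
rewrite Eu11 Eu01 Eu1 Ec0 Ec; split.
  by field; rewrite an sn /= ; move: Dn; rewrite Ec.
by field; rewrite an sn.
Qed.

(* The outward derivative of the logarithm of [|grad u|^2 / u^q] at a boundary
   point where its tangential derivative vanishes is at most 0.  There
   [|grad u|^2 = h^2 + u_s^2], so when [u_s = 0] the second derivative test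
   along the edge bounds [u_ss]; this is where [2 <= q] enters. *)
Lemma boundary_sign (kap h h' us uss E u P q lam : R) :
  0 < u -> 0 < P -> 2 <= q -> 0 < lam -> lam <= 1 / (q - 1) -> 1 <= kap ->
  E = h * h + us * us -> 0 < E ->
  h = P - lam * u -> h' = q * P / u - lam ->
  us * ((2 * h * h' + 2 * uss) / E - q / u) = 0 ->
  (us = 0 -> uss * ((2 * h * h' + 2 * uss) / E - q / u) <= 0) ->
  2 * (- kap * E - h * uss + h' * us * us) - q * E * h / u <= 0.
Proof.
move=> u0 P0 q2 lam0 laml kap1 EE E0 Eh Eh' T0 Ts.
have un : u != 0 by rewrite lt0r_neq0.
have En : E != 0 by rewrite lt0r_neq0.
have lq : lam * (q - 1) <= 1 by rewrite -ler_pdivlMr //; lra.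
(* The power u^q cancels here because the denominator of phi carries the exponent of the boundary
   condition. *)
have hq : h' - q * h / u = (q - 1) * lam by rewrite Eh Eh'; field.
have [us0|usn] := eqVneq us 0; last first.
  move/eqP: T0; rewrite mulf_eq0 (negbTE usn) /= => /eqP T0.
  (* If u_s is nonzero, tangential criticality determines u_ss, and the expression collapses to 2 E
     ((q - 1) lambda - kappa). *)
  have Y : uss = q * E / (2 * u) - h * h'.
    apply/eqP; rewrite -subr_eq0; apply/eqP.
    rewrite -(mulr0 (E / 2)) -T0; field; rewrite En un //.
  have -> : 2 * (- kap * E - h * uss + h' * us * us) - q * E * h / u
     = 2 * E * ((q - 1) * lam - kap).
    have us2 : us * us = E - h * h by rewrite EE; ring.
    rewrite -hq Y -[h' * us * us]mulrA us2; field; rewrite un //.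
  rewrite pmulr_rle0 ?mulr_gt0 //; lra.
have {}Ts := Ts us0.
have EE2 : E = h * h by rewrite EE us0 mulr0 addr0.
have hn : h != 0 by apply: contraNneq En => h0; rewrite EE2 h0 mulr0.
(* The second derivative test becomes z (z - r) <= 0, so z lies between 0 and r, and the claim is z
   <= kappa + q h / (2 u). For z > 0 it follows from z <= r and r - q h / (2 u) = (q - 1) lambda <=
   1. *)
pose z := - uss / h; pose r := h' - q * h / (2 * u).
have hz : z * (z - r) <= 0.
  have : 0 < 2^-1 :> R by rewrite invr_gt0.
  move=> half; have := Ts; rewrite -(pmulr_rle0 _ half).
  suff -> : 2^-1 * (uss * ((2 * h * h' + 2 * uss) / E - q / u)) = z * (z - r) by [].
  by rewrite EE2 /z /r; field; rewrite un hn.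
have -> : 2 * (- kap * E - h * uss + h' * us * us) - q * E * h / u
   = 2 * E * (z - kap - q * h / (2 * u)).
  by rewrite us0 EE2 /z; field; rewrite un hn.
rewrite pmulr_rle0 ?mulr_gt0 //.
have hu : q * h / (2 * u) = q / 2 * (P / u) - q / 2 * lam by rewrite Eh; field.
have Pu : 0 < q / 2 * (P / u) by rewrite mulr_gt0 ?divr_gt0 //; lra.
have rr : r - q * h / (2 * u) = (q - 1) * lam by rewrite /r -hq; field.
(* For z <= 0 one needs kappa + q h / (2 u) >= 0. Its only negative contribution is - q lambda / 2,
   and q / 2 <= q - 1 bounds q lambda / 2 by 1. *)
have ql : q / 2 * lam <= lam * (q - 1) by rewrite mulrC ler_pM2l //; lra.
move: hz rr; rewrite hu; move: Pu ql lq kap1; clear.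
move: (q / 2 * (P / u)) => A.
move=> Pu ql lq kap1 hz rr.
have [z0|z0] := lerP z 0; first lra.
have zr : z - r <= 0 by rewrite -(pmulr_rle0 _ z0).
lra.
Qed.
End JetAlgebra.

(** * Local maxima of phi *)

(** The entries of the jet are the actual derivatives at y. One field serves for both orders of a
    mixed derivative, so symmetry is built in. *)
Record is_jet (R : realType) (J : 'rV[R]_2 -> jet R) (y : 'rV[R]_2) := IsJet {
  gja : has_grad (fun z => ja (J z)) y (ja0 (J y)) (ja1 (J y));
  gja0 : has_grad (fun z => ja0 (J z)) y (ja00 (J y)) (ja01 (J y));
  gja1 : has_grad (fun z => ja1 (J z)) y (ja01 (J y)) (ja11 (J y));
  gjb : has_grad (fun z => jb (J z)) y (jb0 (J y)) (jb1 (J y));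
  gjb0 : has_grad (fun z => jb0 (J z)) y (jb00 (J y)) (jb01 (J y));
  gjb1 : has_grad (fun z => jb1 (J z)) y (jb01 (J y)) (jb11 (J y));
  gjc : has_grad (fun z => jc (J z)) y (jc0 (J y)) (jc1 (J y));
  gjc0 : has_grad (fun z => jc0 (J z)) y (jc00 (J y)) (jc01 (J y));
  gjc1 : has_grad (fun z => jc1 (J z)) y (jc01 (J y)) (jc11 (J y));
  gju : has_grad (fun z => ju (J z)) y (ju0 (J y)) (ju1 (J y));
  gju0 : has_grad (fun z => ju0 (J z)) y (ju00 (J y)) (ju01 (J y));
  gju1 : has_grad (fun z => ju1 (J z)) y (ju01 (J y)) (ju11 (J y));
  gju00 : has_grad (fun z => ju00 (J z)) y (ju000 (J y)) (ju001 (J y));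
  gju01 : has_grad (fun z => ju01 (J z)) y (ju001 (J y)) (ju011 (J y));
  gju11 : has_grad (fun z => ju11 (J z)) y (ju011 (J y)) (ju111 (J y)) }.

Ltac solve_grad_atom H :=
  first [exact: (gja H) | exact: (gja0 H) | exact: (gja1 H)
       | exact: (gjb H) | exact: (gjb0 H) | exact: (gjb1 H)
       | exact: (gjc H) | exact: (gjc0 H) | exact: (gjc1 H)
       | exact: (gju H) | exact: (gju0 H) | exact: (gju1 H)
       | exact: (gju00 H) | exact: (gju01 H) | exact: (gju11 H)].

(** Fills in an unknown gradient by the shape of the expression, with gradients found in the context
    as atoms. A difference is a sum with an opposite and needs no rule; nonvanishing denominators
    are left as goals. *)
Ltac solve_grad H :=
  lazymatch goal with
  | |- has_grad (fun z => @?F z + @?G z) _ _ _ =>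
      apply: (@has_gradD _ F G); [solve_grad H | solve_grad H]
  | |- has_grad (fun z => - @?F z) _ _ _ => apply: (@has_gradN _ F); solve_grad H
  | |- has_grad (fun z => @?F z * @?G z) _ _ _ =>
      apply: (@has_gradM _ F G); [solve_grad H | solve_grad H]
  | |- has_grad (fun z => (@?F z)^-1) _ _ _ =>
      apply: (@has_gradV _ F); [idtac | solve_grad H]
  | |- _ => first [exact: has_grad_cst | solve_grad_atom H | eassumption | idtac]
  end.

(** The vectors v = (1, 0) and w = (-b, a) are orthogonal for the metric, and a times the cofactor
    matrix is det * v^T v + w^T w. Both have a nonnegative second entry, so they are available at
    edge points. *)
Lemma trace_le0 (R : realFieldType) (a b c X Y Z : R) : 0 < a -> 0 < a * c - b * b ->
  1 * 1 * X + 1 * 0 * Z + 0 * 0 * Y <= 0 ->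
  - b * - b * X + - b * a * Z + a * a * Y <= 0 ->
  0 < c * X - b * Z + a * Y -> False.
Proof.
move=> a0 D0 T0 T1 C.
have X0 : X <= 0 by lra.
have : (a * c - b * b) * X <= 0 by rewrite pmulr_rle0.
have : 0 < a * (c * X - b * Z + a * Y) by rewrite mulr_gt0.
lra.
Qed.

(** Kept apart from [boundary_identity] because it is needed at every edge point near x, from the
    undifferentiated boundary condition alone. *)
Lemma edge_energy (R : realType) (j : jet R) (s h : R) :
  ja j != 0 -> jdet j != 0 -> s != 0 -> s * s * jdet j = ja j ->
  s * (jb j / ja j * ju0 j - ju1 j) = h -> jE j = h * h + ju0 j * ju0 j / ja j.
Proof.
case: j => a a0 a1 a00 a01 a11 b b0 b1 b00 b01 b11 c c0 c1 c00 c01 c11 u u0 u1 u00 u01 u11 ? ? ? ?.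
rewrite /jE /jN /jdet /= => an Dn sn s2 nu.
have Ec : c = (a / (s * s) + b * b) / a by rewrite -{1}s2; field; rewrite sn an.
have Eu1 : u1 = b / a * u0 - h / s by rewrite -nu; field; rewrite an sn.
by rewrite Eu1 Ec; field; rewrite an sn.
Qed.

Section LocalMaximum.
Variable R : realType.
Notation P := 'rV[R]_2.
Implicit Types (y v : P) (t d : R).
Variables (J : P -> jet R).

(** * Derivatives of the jet formulas *)

Lemma has_grad_jdet y : is_jet J y -> has_grad (fun z => jdet (J z)) y (jdet0 (J y)) (jdet1 (J y)).
Proof.
move=> H; apply: has_grad_eq; first by rewrite /jdet; solve_grad H.
all: by rewrite /jdet0 /jdet1; ring.
Qed.

Lemma has_grad_jdet0 y : is_jet J y -> has_grad (fun z => jdet0 (J z)) y (jdet00 (J y)) (jdet01 (J y)).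
Proof.
move=> H; apply: has_grad_eq; first by rewrite /jdet0; solve_grad H.
all: by rewrite /jdet00 /jdet01; ring.
Qed.

Lemma has_grad_jdet1 y : is_jet J y -> has_grad (fun z => jdet1 (J z)) y (jdet01 (J y)) (jdet11 (J y)).
Proof.
move=> H; apply: has_grad_eq; first by rewrite /jdet1; solve_grad H.
all: by rewrite /jdet01 /jdet11; ring.
Qed.

Lemma has_grad_jN y : is_jet J y -> has_grad (fun z => jN (J z)) y (jN0 (J y)) (jN1 (J y)).
Proof.
move=> H; apply: has_grad_eq; first by rewrite /jN; solve_grad H.
all: by rewrite /jN0 /jN1; ring.
Qed.

Lemma has_grad_jN0 y : is_jet J y -> has_grad (fun z => jN0 (J z)) y (jN00 (J y)) (jN01 (J y)).
Proof.
move=> H; apply: has_grad_eq; first by rewrite /jN0; solve_grad H.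
all: by rewrite /jN00 /jN01; ring.
Qed.

Lemma has_grad_jN1 y : is_jet J y -> has_grad (fun z => jN1 (J z)) y (jN01 (J y)) (jN11 (J y)).
Proof.
move=> H; apply: has_grad_eq; first by rewrite /jN1; solve_grad H.
all: by rewrite /jN01 /jN11; ring.
Qed.

Lemma has_grad_jL y : is_jet J y -> has_grad (fun z => jL (J z)) y (jL0 (J y)) (jL1 (J y)).
Proof.
move=> H; have HD := has_grad_jdet H; apply: has_grad_eq.
  by rewrite /jL /jH /jq0 /jq1; solve_grad H.
all: by rewrite /jL0 /jL1 /jH0 /jH1 /jq00 /jq01 /jq10 /jq11 /jH /jq0 /jq1; ring.
Qed.

Lemma has_grad_jE y : is_jet J y -> jdet (J y) != 0 ->
  has_grad (fun z => jE (J z)) y (jE0 (J y)) (jE1 (J y)).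
Proof.
move=> H D0; have HD := has_grad_jdet H; have HN := has_grad_jN H; apply: has_grad_eq.
  by rewrite /jE; solve_grad H.
all: by rewrite /jE0 /jE1; field.
Qed.

Lemma has_grad_jE0 y : is_jet J y -> jdet (J y) != 0 ->
  has_grad (fun z => jE0 (J z)) y (jE00 (J y)) (jE01 (J y)).
Proof.
move=> H D0; have HD := has_grad_jdet H; have HN := has_grad_jN H; have HD0 := has_grad_jdet0 H.
have HN0 := has_grad_jN0 H; apply: has_grad_eq.
  by rewrite /jE0; solve_grad H; rewrite mulf_neq0.
all: by rewrite /jE00 /jE01; field.
Qed.

Lemma has_grad_jE1 y : is_jet J y -> jdet (J y) != 0 ->
  has_grad (fun z => jE1 (J z)) y (jE01 (J y)) (jE11 (J y)).
Proof.
move=> H D0; have HD := has_grad_jdet H; have HN := has_grad_jN H; have HD1 := has_grad_jdet1 H.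
have HN1 := has_grad_jN1 H; apply: has_grad_eq.
  by rewrite /jE1; solve_grad H; rewrite mulf_neq0.
all: by rewrite /jE01 /jE11; field.
Qed.

Lemma has_grad_jX0 q y : is_jet J y -> jdet (J y) != 0 -> ju (J y) != 0 ->
  has_grad (fun z => jX0 q (J z)) y (jX00 q (J y)) (jX01 q (J y)).
Proof.
move=> H D0 u0; have HE := has_grad_jE H D0; have HE0 := has_grad_jE0 H D0; apply: has_grad_eq.
  by rewrite /jX0; solve_grad H.
all: by rewrite /jX00 /jX01; field.
Qed.

Lemma has_grad_jX1 q y : is_jet J y -> jdet (J y) != 0 -> ju (J y) != 0 ->
  has_grad (fun z => jX1 q (J z)) y (jX10 q (J y)) (jX11 q (J y)).
Proof.
move=> H D0 u0; have HE := has_grad_jE H D0; have HE0 := has_grad_jE1 H D0; apply: has_grad_eq.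
  by rewrite /jX1; solve_grad H.
all: by rewrite /jX10 /jX11; field.
Qed.

(** The power q - 1 is rewritten as u^q / u, so that u^q is the only power that [field] meets. *)
Lemma has_grad_powR q y : is_jet J y -> 0 < q -> 0 < ju (J y) ->
  has_grad (fun z => powR (ju (J z)) q) y
    (q * powR (ju (J y)) q * ju0 (J y) / ju (J y))
    (q * powR (ju (J y)) q * ju1 (J y) / ju (J y)).
Proof.
move=> H q0 u0; have un : ju (J y) != 0 by rewrite lt0r_neq0.
have e : powR (ju (J y)) (q - 1) = powR (ju (J y)) q / ju (J y).
  by rewrite -(mulr_powRB1 (ltW u0) q0) mulrC mulKf.
apply: has_grad_eq.
  by apply: (@has_grad_comp1 _ (fun t => powR t q) (fun z => ju (J z))
    _ _ _ _ (is_derive1_powR q u0) (gju H)).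
all: by rewrite e; field.
Qed.

Definition phi (q : R) (j : jet R) : R := jE j / powR (ju j) q.

Lemma has_grad_phi q y : is_jet J y -> jdet (J y) != 0 -> 0 < q -> 0 < ju (J y) ->
  has_grad (fun z => phi q (J z)) y (jX0 q (J y) / powR (ju (J y)) q)
     (jX1 q (J y) / powR (ju (J y)) q).
Proof.
move=> H D0 q0 u0; have un : ju (J y) != 0 by rewrite lt0r_neq0.
have P0 : powR (ju (J y)) q != 0 by rewrite lt0r_neq0 // powR_gt0.
have HE := has_grad_jE H D0; have HP := has_grad_powR H q0 u0; apply: has_grad_eq.
  by rewrite /phi; solve_grad H.
all: by rewrite /jX0 /jX1; field; rewrite un P0.
Qed.


(** The derivative is recorded through that of [jsig]^2 = a / det, which keeps square roots out of
    the later algebra. *)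
Lemma has_grad_jsig y : is_jet J y -> 0 < ja (J y) -> 0 < jdet (J y) ->
  exists s0 s1, has_grad (fun z => jsig (J z)) y s0 s1 /\
   2 * jsig (J y) * s0 * jdet (J y) * jdet (J y)
   = ja0 (J y) * jdet (J y) - ja (J y) * jdet0 (J y).
Proof.
move=> H a0 D0; have HD := has_grad_jdet H.
have Dn : jdet (J y) != 0 by rewrite lt0r_neq0.
have r0 : 0 < ja (J y) / jdet (J y) by rewrite divr_gt0.
have g : has_grad (fun z => ja (J z) / jdet (J z)) y
   ((ja0 (J y) * jdet (J y) - ja (J y) * jdet0 (J y)) / (jdet (J y) * jdet (J y)))
   ((ja1 (J y) * jdet (J y) - ja (J y) * jdet1 (J y)) / (jdet (J y) * jdet (J y))).
  apply: has_grad_eq; first by solve_grad H.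
    by cbv beta; field.
  by cbv beta; field.
have hs := @has_grad_comp1 _ Num.sqrt (fun z => ja (J z) / jdet (J z)) _ _ _ _ (is_derive1_sqrt r0) g.
do 2![eexists]; split; first exact: hs.
have sn : jsig (J y) != 0 by rewrite lt0r_neq0 // sqrtr_gt0.
rewrite -/(jsig (J y)); field; rewrite sn Dn //.
Qed.

(** * A maximum point of phi in one chart *)

Variables (U : set P) (x : P) (lam q : R).
Hypotheses (oU : open U) (Ux : U x) (Hx : half_plane x).
Hypotheses (HJ : forall y, U y -> is_jet J y).
Hypotheses (a_gt0 : forall y, U y -> 0 < ja (J y))
  (D_gt0 : forall y, U y -> 0 < jdet (J y)) (u_gt0 : forall y, U y -> 0 < ju (J y)).
Hypotheses (lam_gt0 : 0 < lam) (q_ge2 : 2 <= q) (lam_le : lam <= 1 / (q - 1)).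
Hypotheses (harm : forall y, U y -> half_plane y -> jL (J y) = 0).
Hypotheses (K_ge0 : 0 <= jK (J x)).
Hypotheses (bd : x 0 1 = 0 -> 1 <= jkap (J x) /\
  forall y, U y -> y 0 1 = 0 -> jnu (J y) + lam * ju (J y) = powR (ju (J y)) q).
Hypotheses (phi_max : forall y, U y -> half_plane y -> phi q (J y) <= phi q (J x)).

(** At interior points every direction is admissible, on the edge only those not pointing outwards;
    the disjunction treats both cases at once. *)
Lemma inward_ray v : 0 < x 0 1 \/ 0 <= v 0 1 ->
  exists2 d, 0 < d & forall t, 0 < t < d -> U (x + t *: v) /\ half_plane (x + t *: v).
Proof.
move=> hv; have v1 : 0 < `|v| + 1 by rewrite ltr_wpDl.
have [d2 d20 inU] := open_ball oU Ux.
have [d1 d10 hd] : exists2 d, 0 < d & forall t, 0 < t < d -> 0 <= x 0 1 + t * v 0 1.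
  case: hv => h; last first.
    exists 1 => // t /andP[t0 _]; apply: addr_ge0 => //; apply: mulr_ge0 => //; exact: ltW.
  exists (x 0 1 / (`|v| + 1)); first by rewrite divr_gt0.
  move=> t /andP[t0]; rewrite ltr_pdivlMr // => k.
  have : `|t * v 0 1| <= t * `|v|.
    by rewrite normrM gtr0_norm // ler_pM2l // norm_coord_le.
  rewrite ler_norml => /andP[k2 _]; lra.
exists (Num.min d1 (d2 / (`|v| + 1))); first by rewrite lt_min d10 divr_gt0.
move=> t; rewrite lt_min ltr_pdivlMr // => /andP[t0 /andP[t1 t2]]; split.
  apply: inU; rewrite addrAC subrr add0r normrZ gtr0_norm //; lra.
by rewrite /half_plane /= !mxE hd // t0.
Qed.

Let Hx1 : 0 <= x 0 1. Proof. exact: Hx. Qed.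
Let J_x := HJ Ux.
Let D_x : jdet (J x) != 0. Proof. by rewrite lt0r_neq0 // D_gt0. Qed.
Let u_x : ju (J x) != 0. Proof. by rewrite lt0r_neq0 // u_gt0. Qed.
Let a_x : ja (J x) != 0. Proof. by rewrite lt0r_neq0 // a_gt0. Qed.
Let q_gt0 : 0 < q. Proof. by apply: lt_le_trans q_ge2; rewrite ltr0n. Qed.
Let P_gt0 : 0 < powR (ju (J x)) q. Proof. by rewrite powR_gt0 // u_gt0. Qed.

Lemma e_1_1 : (e_ 1 : P) 0 1 = 1. Proof. by rewrite e_E. Qed.
Lemma e_0_1 : (e_ 0 : P) 0 1 = 0. Proof. by rewrite e_E. Qed.

(** The first order test is applied to F and to - F. This yields the derivatives of [jL] at edge
    points, where [jL] need not vanish beyond the edge. *)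
Lemma const_ray F v p r : has_grad F x p r -> 0 < x 0 1 \/ 0 <= v 0 1 ->
  (forall y, U y -> half_plane y -> F y = 0) -> linf p r v = 0.
Proof.
move=> hF hv F0; have [d d0 hd] := inward_ray hv.
apply/eqP; rewrite eq_le; apply/andP; split.
  apply: (ray_le0 d0 hF) => t /hd[Ut Ht]; by rewrite !F0.
have -> : linf p r v = - linf (- p) (- r) v by rewrite /linf; ring.
rewrite oppr_ge0; apply: (ray_le0 d0 (has_gradN hF)) => t /hd[Ut Ht].
by rewrite !F0.
Qed.

Lemma harm0 : jL0 (J x) = 0.
Proof.
have := const_ray (has_grad_jL J_x) (v := e_ 0) _ harm; rewrite linf_e; apply.
by rewrite e_0_1; right.
Qed.

Lemma harm1 : jL1 (J x) = 0.
Proof.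
have := const_ray (has_grad_jL J_x) (v := e_ 1) _ harm; rewrite linf_e; apply.
by rewrite e_1_1; right.
Qed.

Lemma phi_ray v : 0 < x 0 1 \/ 0 <= v 0 1 -> linf (jX0 q (J x)) (jX1 q (J x)) v <= 0.
Proof.
move=> hv; have [d d0 hd] := inward_ray hv.
have := ray_le0 d0 (has_grad_phi J_x D_x q_gt0 (u_gt0 Ux)) (v := v).
have -> : linf (jX0 q (J x) / powR (ju (J x)) q) (jX1 q (J x) / powR (ju (J x)) q) v
  = (powR (ju (J x)) q)^-1 * linf (jX0 q (J x)) (jX1 q (J x)) v by rewrite /linf; ring.
rewrite pmulr_rle0 ?invr_gt0 //; apply => t /hd[Ut Ht]; exact: phi_max.
Qed.

(** Both e_0 and - e_0 are parallel to the edge, hence admissible at every point. *)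
Lemma phi_tangential : jX0 q (J x) = 0.
Proof.
apply/eqP; rewrite eq_le; apply/andP; split.
  by have := phi_ray (v := e_ 0); rewrite linf_e e_0_1; apply; right.
have := phi_ray (v := - e_ 0); rewrite /linf !mxE /= => h.
have : - 1%:R * jX0 q (J x) + - 0%:R * jX1 q (J x) <= 0 by apply: h; right; rewrite oppr0.
by rewrite mulNr mul1r oppr0 mul0r addr0 oppr_le0.
Qed.

Lemma not_critical : 0 < jE (J x) -> jX1 q (J x) = 0 -> False.
Proof.
move=> E0 X1; have X0 := phi_tangential.
have En : jE (J x) != 0 by rewrite lt0r_neq0.
have C := critical_laplacian D_x u_x En (harm Ux Hx) harm0 harm1 X0 X1.
have Cpos : 0 < jc (J x) * jX00 q (J x) - jb (J x) * (jX01 q (J x) + jX10 q (J x))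
    + ja (J x) * jX11 q (J x).
  have : 0 < (jc (J x) * jX00 q (J x) - jb (J x) * (jX01 q (J x) + jX10 q (J x))
    + ja (J x) * jX11 q (J x)) / jdet (J x).
    have uu : 0 < ju (J x) * ju (J x) by apply: mulr_gt0; exact: u_gt0.
    rewrite C; apply: ltr_wpDl.
      by apply: mulr_ge0; [apply: mulr_ge0; [exact: ler0n|exact: K_ge0]|exact: ltW].
    by apply: divr_gt0 uu; exact: mulr_gt0 (mulr_gt0 q_gt0 E0) E0.
  by rewrite pmulr_lgt0 // invr_gt0 D_gt0.
have test v : 0 <= v 0 1 ->
    v 0 0 * v 0 0 * jX00 q (J x) + v 0 0 * v 0 1 * (jX01 q (J x) + jX10 q (J x))
     + v 0 1 * v 0 1 * jX11 q (J x) <= 0.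
  move=> hv; have [d d0 hd] := inward_ray (or_intror hv).
  (* These are the partial derivatives of phi. As [jX0] and [jX1] vanish at x, differentiating the
     factor u^-q contributes nothing there. *)
  pose f0 y := jX0 q (J y) / powR (ju (J y)) q.
  pose f1 y := jX1 q (J y) / powR (ju (J y)) q.
  have Pn : powR (ju (J x)) q != 0 by rewrite lt0r_neq0.
  have gP := has_grad_powR J_x q_gt0 (u_gt0 Ux).
  have g0 : has_grad f0 x (jX00 q (J x) / powR (ju (J x)) q) (jX01 q (J x) / powR (ju (J x)) q).
    have G := has_grad_jX0 q J_x D_x u_x; apply: has_grad_eq; first by rewrite /f0; solve_grad J_x.
    by cbv beta; rewrite X0 mul0r addr0.
    by cbv beta; rewrite X0 mul0r addr0.
  have g1 : has_grad f1 x (jX10 q (J x) / powR (ju (J x)) q) (jX11 q (J x) / powR (ju (J x)) q).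
    have G := has_grad_jX1 q J_x D_x u_x; apply: has_grad_eq; first by rewrite /f1; solve_grad J_x.
    by cbv beta; rewrite X1 mul0r addr0.
    by cbv beta; rewrite X1 mul0r addr0.
  have hphi y : U y -> has_grad (fun z => phi q (J z)) y (f0 y) (f1 y).
    by move=> Uy; apply: has_grad_phi; rewrite ?lt0r_neq0 ?D_gt0 ?u_gt0 //; exact: HJ.
  have := ray_le0_2 d0 oU Ux hphi g0 g1 (v := v) => K.
  rewrite -(pmulr_rle0 _ (_ : 0 < (powR (ju (J x)) q)^-1)) ?invr_gt0 //.
  apply: le_trans (K _ _); last first.
    by move=> t /hd[Ut Ht]; exact: phi_max.
    by rewrite /f0 /f1 X0 X1 /linf !mul0r !mulr0 addr0.
  by rewrite le_eqVlt; apply/orP; left; apply/eqP; ring.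
have T0 := test (\row_i (if i == 0 then 1 else 0)).
have T1 := test (\row_i (if i == 0 then - jb (J x) else ja (J x))).
move: T0 T1; rewrite !mxE /= lexx (ltW (a_gt0 Ux)) => /(_ isT) T0 /(_ isT) T1.
have := D_gt0 Ux; rewrite /jdet; have := a_gt0 Ux => A0 D0.
move: A0 D0 T0 T1 Cpos; exact: trace_le0.
Qed.

Lemma edge_ray v : x 0 1 = 0 -> v 0 1 = 0 ->
  exists2 d, 0 < d & forall t, 0 < t < d ->
    [/\ U (x + t *: v), half_plane (x + t *: v) & (x + t *: v) 0 1 = 0].
Proof.
move=> x1 v1; have hv : 0 <= v 0 1 by rewrite v1.
have [d d0 hd] := inward_ray (or_intror hv).
by exists d => // t /hd[? ?]; split=> //; rewrite !mxE x1 v1 mulr0 addr0.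
Qed.

Let Ne01 : (- e_ 0 : P) 0 1 = 0. Proof. by rewrite mxE e_0_1 oppr0. Qed.

Lemma edge_le0 F p r v : has_grad F x p r -> x 0 1 = 0 -> v 0 1 = 0 ->
  (forall y, U y -> half_plane y -> y 0 1 = 0 -> F y <= F x) -> linf p r v <= 0.
Proof.
move=> hF x1 v1 h; have [d d0 hd] := edge_ray x1 v1.
by apply: (ray_le0 d0 hF) => t /hd[Ut Ht Et]; exact: h.
Qed.

Lemma edge_max F p r : has_grad F x p r -> x 0 1 = 0 ->
  (forall y, U y -> half_plane y -> y 0 1 = 0 -> F y <= F x) -> p = 0.
Proof.
move=> hF x1 h; apply/eqP; rewrite eq_le; apply/andP; split.
  by have := edge_le0 hF x1 e_0_1 h; rewrite linf_e.
have := edge_le0 hF x1 Ne01 h; rewrite -scaleN1r linfZ linf_e /=.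
by rewrite mulN1r oppr_le0.
Qed.

Lemma jsig_gt0 y : U y -> 0 < jsig (J y).
Proof. by move=> Uy; rewrite sqrtr_gt0 divr_gt0 // ?a_gt0 ?D_gt0. Qed.

Lemma jsig_sqr y : U y -> jsig (J y) * jsig (J y) * jdet (J y) = ja (J y).
Proof.
move=> Uy; rewrite -expr2 sqr_sqrtr ?divfK ?lt0r_neq0 ?D_gt0 //.
by rewrite divr_ge0 // ltW // ?a_gt0 ?D_gt0.
Qed.

(** Maximality says that phi does not increase inwards, and the boundary computation that it does
    not increase outwards; so the transversal derivative is zero. *)
Lemma boundary_critical : x 0 1 = 0 -> 0 < jE (J x) -> jX1 q (J x) = 0.
Proof.
move=> x1 E0; have [kap1 nu] := bd x1.
have En : jE (J x) != 0 by rewrite lt0r_neq0.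
have Pn : powR (ju (J x)) q != 0 by rewrite lt0r_neq0.
have sx : 0 < jsig (J x) by exact: jsig_gt0.
have sn : jsig (J x) != 0 by rewrite lt0r_neq0.
pose pw y := powR (ju (J y)) q.
pose h y := pw y - lam * ju (J y).
pose h' y := q * pw y / ju (J y) - lam.
have nuh y : U y -> y 0 1 = 0 -> jsig (J y) * (jb (J y) / ja (J y) * ju0 (J y) - ju1 (J y)) = h y.
  by move=> Uy y1; rewrite /h /pw -(nu y Uy y1) addrK.
have [s0 [s1 [gs s0E]]] := has_grad_jsig J_x (a_gt0 Ux) (D_gt0 Ux).
have gP y (Uy : U y) := has_grad_powR (HJ Uy) q_gt0 (u_gt0 Uy).
have nu' : s0 * (jb (J x) / ja (J x) * ju0 (J x) - ju1 (J x))
   + jsig (J x) * ((jb0 (J x) * ja (J x) - jb (J x) * ja0 (J x)) / (ja (J x) * ja (J x)) * ju0 (J x)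
       + jb (J x) / ja (J x) * ju00 (J x) - ju01 (J x)) = h' x * ju0 (J x).
  (* By the boundary condition [G] vanishes on the edge, so its tangential derivative is zero: this
     is the boundary condition differentiated along the edge. *)
  pose G y := jsig (J y) * (jb (J y) / ja (J y) * ju0 (J y) - ju1 (J y))
     + lam * ju (J y) - pw y.
  have G0 y : U y -> half_plane y -> y 0 1 = 0 -> G y <= G x.
    by move=> Uy _ y1; rewrite /G !nuh // /h !subrK !subrr.
  have GP := gP x Ux.
  have [r gG] : exists r, has_grad G x (s0 * (jb (J x) / ja (J x) * ju0 (J x) - ju1 (J x))
     + jsig (J x) * ((jb0 (J x) * ja (J x) - jb (J x) * ja0 (J x)) / (ja (J x) * ja (J x)) * ju0 (J x)
         + jb (J x) / ja (J x) * ju00 (J x) - ju01 (J x)) - h' x * ju0 (J x)) r.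
    eexists; apply: has_grad_eq; first by rewrite /G /pw; solve_grad J_x; exact: a_x.
      by rewrite /h' /pw; cbv beta; field; rewrite u_x a_x.
    reflexivity.
  by apply/eqP; rewrite -subr_eq0; apply/eqP; exact: edge_max gG x1 G0.
have [I1 I2] := boundary_identity a_x D_x sn (jsig_sqr Ux) s0E (harm Ux Hx) (nuh x Ux x1) nu'.
(* [M] continues the edge expression h^2 + u_s^2 of [jE] to all of U and agrees with [jE] on the
   edge. It contains no [ju1], and the tangential derivative of M / u^q has the factor [ju0], with
   cofactor [Z]. *)
pose M y := h y * h y + ju0 (J y) * ju0 (J y) / ja (J y).
pose Z y := (2 * h y * h' y + 2 * ju00 (J y) / ja (J y)
   - ju0 (J y) * ja0 (J y) / (ja (J y) * ja (J y)) - q * M y / ju (J y)) / pw y.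
pose f1 y := (2 * h y * h' y * ju1 (J y) + 2 * ju0 (J y) * ju01 (J y) / ja (J y)
   - ju0 (J y) * ju0 (J y) * ja1 (J y) / (ja (J y) * ja (J y)) - q * M y * ju1 (J y) / ju (J y)) / pw y.
have an y : U y -> ja (J y) != 0 by move=> Uy; rewrite lt0r_neq0 // a_gt0.
have un y : U y -> ju (J y) != 0 by move=> Uy; rewrite lt0r_neq0 // u_gt0.
have pn y : U y -> pw y != 0 by move=> Uy; rewrite lt0r_neq0 // powR_gt0 // u_gt0.
have gM y : U y -> has_grad (fun z => M z / pw z) y (ju0 (J y) * Z y) (f1 y).
  move=> Uy; have GP := gP y Uy; have H := HJ Uy; have A := an y Uy.
  have B := un y Uy; have C := pn y Uy; rewrite /pw in C.
  apply: has_grad_eq; first by rewrite /M /h /pw; solve_grad H; assumption.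
    by rewrite /Z /M /h' /h /pw; cbv beta; field; rewrite A B C.
  by rewrite /f1 /M /h' /h /pw; cbv beta; field; rewrite A B C.
have edgeM y : U y -> half_plane y -> y 0 1 = 0 -> M y / pw y <= M x / pw x.
  move=> Uy Hy y1; have := phi_max Uy Hy; rewrite /phi -/(pw y) -/(pw x).
  rewrite (edge_energy (an y Uy) _ _ (jsig_sqr Uy) (nuh y Uy y1)) ?lt0r_neq0 ?D_gt0 ?jsig_gt0 //.
  by rewrite I2.
have T1 := edge_max (gM x Ux) x1 edgeM.
have gZ : exists z0 z1, has_grad Z x z0 z1.
  have GP := gP x Ux; do 2!eexists.
  rewrite /Z /M /h' /h /pw; solve_grad J_x; rewrite ?mulf_neq0 //; exact: a_x.
have [z0 [z1 gZ']] := gZ.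
have gf1 : exists z0 z1, has_grad f1 x z0 z1.
  have GP := gP x Ux; do 2!eexists.
  rewrite /f1 /M /h' /h /pw; solve_grad J_x; rewrite ?mulf_neq0 //; exact: a_x.
have [w0 [w1 gf1']] := gf1.
(* When u_0 vanishes at x, the derivative of u_0 Z along the edge reduces to u_00 Z, so this is the
   second order test for M / u^q. *)
have T2 : ju0 (J x) = 0 -> ju00 (J x) * Z x <= 0.
  move=> u00; have [d d0 hd] := edge_ray x1 e_0_1.
  have gf0 : has_grad (fun z => ju0 (J z) * Z z) x
     (ju00 (J x) * Z x + ju0 (J x) * z0) (ju01 (J x) * Z x + ju0 (J x) * z1).
    exact: has_gradM (gju0 J_x) gZ'.
  have := ray_le0_2 d0 oU Ux gM gf0 gf1' (v := e_ 0).
  rewrite linf_e /= !e_E /= u00 !(mul1r, mul0r, addr0); apply=> //.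
  by move=> t /hd[? ? ?]; exact: edgeM.
pose us := ju0 (J x) / Num.sqrt (ja (J x)).
have sa : Num.sqrt (ja (J x)) != 0 by rewrite lt0r_neq0 // sqrtr_gt0 a_gt0.
have us2 : us * us = ju0 (J x) * ju0 (J x) / ja (J x).
  rewrite -[in RHS](sqr_sqrtr (ltW (a_gt0 Ux))) /us; field; exact: sa.
pose uss := ju00 (J x) / ja (J x) - ju0 (J x) * ja0 (J x) / (2 * ja (J x) * ja (J x)).
have TZ : (2 * h x * h' x + 2 * uss) / jE (J x) - q / ju (J x) = Z x * pw x / jE (J x).
  rewrite /Z {1}/M -I2 /uss; field.
  by rewrite En u_x a_x -/(pw x) pn.
have S := @boundary_sign R (jkap (J x)) (h x) (h' x) us uss (jE (J x)) (ju (J x)) (pw x) q lam.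
have {}S := S (u_gt0 Ux) P_gt0 q_ge2 lam_gt0 lam_le kap1.
rewrite us2 in S; have {}S := S I2 E0 erefl erefl; rewrite TZ in S.
have {}S : 2 * (- jkap (J x) * jE (J x) - h x * uss + h' x * us * us)
    - q * jE (J x) * h x / ju (J x) <= 0.
  apply: S.
    have -> : us * (Z x * pw x / jE (J x)) =
      (ju0 (J x) * Z x) * (pw x / (Num.sqrt (ja (J x)) * jE (J x))).
      by rewrite /us; field; rewrite sa En.
    by rewrite T1 mul0r.
  move/eqP; rewrite mulf_eq0 invr_eq0 (negbTE sa) orbF => /eqP u00.
  have -> : uss * (Z x * pw x / jE (J x)) =
      (ju00 (J x) * Z x) * (pw x / (ja (J x) * jE (J x))).
    by rewrite /uss u00; field; rewrite a_x En.
  apply: mulr_le0_ge0; first exact: T2.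
  by rewrite ltW // divr_gt0 // mulr_gt0 // a_gt0.
have X0 := phi_tangential.
(* As [jX0] is zero at x, this quantity is u^q times the outer normal derivative of phi. *)
have e : - (jsig (J x) * jX1 q (J x)) <= 0.
  apply: le_trans S; rewrite le_eqVlt; apply/orP; left; apply/eqP.
  have -> : - (jsig (J x) * jX1 q (J x)) =
     jsig (J x) * (jb (J x) / ja (J x) * jX0 q (J x) - jX1 q (J x)) by rewrite X0; ring.
  have -> : jsig (J x) * (jb (J x) / ja (J x) * jX0 q (J x) - jX1 q (J x)) =
     jsig (J x) * (jb (J x) / ja (J x) * jE0 (J x) - jE1 (J x))
     - q * jE (J x) / ju (J x) * (jsig (J x) * (jb (J x) / ja (J x) * ju0 (J x) - ju1 (J x))).
    by rewrite /jX0 /jX1; field; rewrite u_x a_x.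
  rewrite I1 nuh // -[h' x * us * us]mulrA us2 /uss -/(jkap (J x)).
  by field; rewrite a_x u_x.
apply/eqP; rewrite eq_le; apply/andP; split.
  have := phi_ray (v := e_ 1); rewrite linf_e e_1_1; apply; right; exact: ler01.
by move: e; rewrite oppr_le0 pmulr_rge0.
Qed.

Lemma local_max : jE (J x) <= 0.
Proof.
rewrite leNgt; apply/negP => E0; apply: (not_critical E0).
have [x1|x1] := eqVneq (x 0 1) 0; first exact: boundary_critical.
have x0 : 0 < x 0 1 by rewrite lt0r x1 Hx1.
have h0 := phi_ray (or_introl x0).
apply/eqP; rewrite eq_le; apply/andP; split; first by have := h0 (e_ 1); rewrite linf_e.
have := h0 (- e_ 1); rewrite -scaleN1r linfZ linf_e /=.
by rewrite mulN1r oppr_le0.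
Qed.

End LocalMaximum.

(** * Geometric operators in terms of jets *)

Section Matrices2.
Variable F : fieldType.
Implicit Types A B : 'M[F]_2.

Lemma mx2P A B : A 0 0 = B 0 0 -> A 0 1 = B 0 1 -> A 1 0 = B 1 0 -> A 1 1 = B 1 1 -> A = B.
Proof.
move=> ? ? ? ?; apply/matrixP => i j.
by case: (ord2_cases i) => ->; case: (ord2_cases j) => ->.
Qed.

Lemma det_mx2 A : \det A = A 0 0 * A 1 1 - A 0 1 * A 1 0.
Proof.
rewrite (expand_det_row _ 0) sum2 /cofactor !det_mx11 !mxE /=.
have -> : lift 0 0 = 1 :> 'I_2 by apply: val_inj.
have -> : lift 1 0 = 0 :> 'I_2 by apply: val_inj.
by rewrite expr0 expr1 mul1r mulN1r mulrN.
Qed.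

Lemma inv_mx2 A : \det A != 0 ->
  [/\ invmx A 0 0 = A 1 1 / \det A, invmx A 0 1 = - A 0 1 / \det A,
      invmx A 1 0 = - A 1 0 / \det A & invmx A 1 1 = A 0 0 / \det A].
Proof.
move=> D0; have uA : A \in unitmx by rewrite unitmxE unitfE.
pose B : 'M[F]_2 := \matrix_(i, j) (if i == 0 then if j == 0 then A 1 1 / \det A else - A 0 1 / \det A
    else if j == 0 then - A 1 0 / \det A else A 0 0 / \det A).
have BA : B *m A = 1%:M.
  apply: mx2P; rewrite !mxE !sum2 !mxE /=; move: D0; rewrite det_mx2 => D0; field => //.
have -> : invmx A = B by rewrite -[LHS]mul1mx -BA mulmxK.
by split; rewrite mxE.
Qed.
End Matrices2.

(** In these names the first digit is the upper index of the Christoffel symbol and the other two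
    are its lower indices. *)
Definition jG000 (R : realType) (j : jet R) := (jc j * ja0 j - jb j * (2 * jb0 j - ja1 j)) / (2 * jdet j).
Definition jG100 (R : realType) (j : jet R) := (ja j * (2 * jb0 j - ja1 j) - jb j * ja0 j) / (2 * jdet j).
Definition jG001 (R : realType) (j : jet R) := (jc j * ja1 j - jb j * jc0 j) / (2 * jdet j).
Definition jG101 (R : realType) (j : jet R) := (ja j * jc0 j - jb j * ja1 j) / (2 * jdet j).
Definition jG011 (R : realType) (j : jet R) := (jc j * (2 * jb1 j - jc0 j) - jb j * jc1 j) / (2 * jdet j).
Definition jG111 (R : realType) (j : jet R) := (ja j * jc1 j - jb j * (2 * jb1 j - jc0 j)) / (2 * jdet j).

Section Linking.
Variable R : realType.
Notation P := 'rV[R]_2.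
Implicit Types (y z v : P).
Variables (U : set P) (J : P -> jet R) (g : P -> 'M[R]_2) (f : P -> R).
Hypotheses (oU : open U) (HJ : forall y, U y -> is_jet J y).
Hypotheses (a_gt0 : forall y, U y -> 0 < ja (J y)) (D_gt0 : forall y, U y -> 0 < jdet (J y)).
Hypotheses (g00 : forall y, U y -> half_plane y -> g y 0 0 = ja (J y))
  (g01 : forall y, U y -> half_plane y -> g y 0 1 = jb (J y))
  (g10 : forall y, U y -> half_plane y -> g y 1 0 = jb (J y))
  (g11 : forall y, U y -> half_plane y -> g y 1 1 = jc (J y))
  (fu : forall y, U y -> half_plane y -> f y = ju (J y)).

Lemma nablaE (X Y : vfield R) y k : nabla g X Y y 0 k =
  X y 0 0 * (pd 0 (fun z => Y z 0 k) y
     + (christoffel g k 0 0 y * Y y 0 0 + christoffel g k 0 1 y * Y y 0 1))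
  + X y 0 1 * (pd 1 (fun z => Y z 0 k) y
     + (christoffel g k 1 0 y * Y y 0 0 + christoffel g k 1 1 y * Y y 0 1)).
Proof. by rewrite /nabla mxE !sum2. Qed.

Lemma innerE (X Y : vfield R) y : inner g X Y y =
  (X y 0 0 * g y 0 0 + X y 0 1 * g y 1 0) * Y y 0 0
  + (X y 0 0 * g y 0 1 + X y 0 1 * g y 1 1) * Y y 0 1.
Proof. by rewrite /inner mxE sum2 !mxE !sum2. Qed.

Lemma normalizeE (X : vfield R) y k :
  normalize g X y 0 k = (Num.sqrt (inner g X X y))^-1 * X y 0 k.
Proof. by rewrite /normalize mxE. Qed.

Lemma outer_normalE y k : outer_normal g y 0 k =
  - normalize g (grad g (fun z : P => z 0 1)) y 0 k.
Proof. by rewrite /outer_normal mxE. Qed.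

Lemma coord_fieldE i y k : @coord_field R i y 0 k = (k == i)%:R.
Proof. by rewrite /coord_field mxE eqxx. Qed.

Let Dn y : U y -> jdet (J y) != 0.
Proof. by move=> Uy; rewrite lt0r_neq0 // D_gt0. Qed.

Let an y : U y -> ja (J y) != 0.
Proof. by move=> Uy; rewrite lt0r_neq0 // a_gt0. Qed.

Lemma link_det y : U y -> half_plane y -> \det (g y) = jdet (J y).
Proof. by move=> Uy Hy; rewrite det_mx2 g00 // g01 // g10 // g11. Qed.

Lemma link_inv y : U y -> half_plane y ->
  [/\ invmx (g y) 0 0 = jc (J y) / jdet (J y), invmx (g y) 0 1 = - jb (J y) / jdet (J y),
      invmx (g y) 1 0 = - jb (J y) / jdet (J y) & invmx (g y) 1 1 = ja (J y) / jdet (J y)].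
Proof.
move=> Uy Hy; have := @inv_mx2 _ (g y); rewrite link_det // g00 // g01 // g10 // g11 //.
by apply; exact: Dn.
Qed.

Lemma link_pd (F G : P -> R) y p q : U y -> half_plane y ->
  (forall z, U z -> half_plane z -> F z = G z) -> has_grad G y p q ->
  pd 0 F y = p /\ pd 1 F y = q.
Proof. by move=> Uy Hy FG hG; split; rewrite (pd_eq _ oU Uy Hy FG hG). Qed.

Lemma link_christoffel y : U y -> half_plane y ->
  [/\ christoffel g 0 0 0 y = jG000 (J y) /\ christoffel g 1 0 0 y = jG100 (J y),
      christoffel g 0 0 1 y = jG001 (J y) /\ christoffel g 1 0 1 y = jG101 (J y),
      christoffel g 0 1 0 y = jG001 (J y) /\ christoffel g 1 1 0 y = jG101 (J y) &
      christoffel g 0 1 1 y = jG011 (J y) /\ christoffel g 1 1 1 y = jG111 (J y)].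
Proof.
move=> Uy Hy; have H := HJ Uy; have D0 := Dn Uy.
have [i00 i01 i10 i11] := link_inv Uy Hy.
have [a0 a1] := link_pd Uy Hy g00 (gja H).
have [b0 b1] := link_pd Uy Hy g01 (gjb H).
have [b0' b1'] := link_pd Uy Hy g10 (gjb H).
have [c0 c1] := link_pd Uy Hy g11 (gjc H).
by split; split; rewrite /christoffel sum2 ?i00 ?i01 ?i10 ?i11 ?a0 ?a1 ?b0 ?b1 ?b0' ?b1' ?c0 ?c1
  /jG000 /jG001 /jG011 /jG100 /jG101 /jG111; field; rewrite D0.
Qed.

Lemma link_df y : U y -> half_plane y -> pd 0 f y = ju0 (J y) /\ pd 1 f y = ju1 (J y).
Proof. by move=> Uy Hy; apply: link_pd Uy Hy fu (gju (HJ Uy)). Qed.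

Definition jV0 (j : jet R) := (jc j * ju0 j - jb j * ju1 j) / jdet j.
Definition jV1 (j : jet R) := (ja j * ju1 j - jb j * ju0 j) / jdet j.

Lemma link_grad y : U y -> half_plane y ->
  grad g f y 0 0 = jV0 (J y) /\ grad g f y 0 1 = jV1 (J y).
Proof.
move=> Uy Hy; have D0 := Dn Uy.
have [i00 i01 i10 i11] := link_inv Uy Hy; have [u0 u1] := link_df Uy Hy.
by split; rewrite /grad !mxE sum2 !mxE u0 u1 ?i00 ?i01 ?i10 ?i11 /jV0 /jV1; field.
Qed.

Lemma link_energy y : U y -> half_plane y ->
  ((\row_j pd j f y) *m invmx (g y) *m (\row_j pd j f y)^T) 0 0 = jE (J y).
Proof.
move=> Uy Hy; have D0 := Dn Uy; have [V0 V1] := link_grad Uy Hy.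
have [u0 u1] := link_df Uy Hy.
rewrite -/(grad g f y) mxE sum2 V0 V1 !mxE u0 u1 /jV0 /jV1 /jE /jN; by field.
Qed.

Lemma link_laplace y : U y -> half_plane y ->
  laplace_beltrami g f y = jL (J y) / (2 * jdet (J y) * jdet (J y)).
Proof.
move=> Uy Hy; have H := HJ Uy; have HD := has_grad_jdet H; have D0 := Dn Uy.
have [[G000 G100] [G001 G101] [G010 G110] [G011 G111]] := link_christoffel Uy Hy.
have [V0 V1] := link_grad Uy Hy.
(* The gradient is left open and computed by [solve_grad]; the closing [field] reconciles its form
   with [jL]. *)
eassert (gV0 : has_grad (fun z => jV0 (J z)) y _ _).
  by rewrite /jV0; solve_grad H; exact: D0.
eassert (gV1 : has_grad (fun z => jV1 (J z)) y _ _).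
  by rewrite /jV1; solve_grad H; exact: D0.
have [V00 _] := link_pd Uy Hy (fun z Uz Hz => (link_grad Uz Hz).1) gV0.
have [_ V11] := link_pd Uy Hy (fun z Uz Hz => (link_grad Uz Hz).2) gV1.
rewrite /laplace_beltrami /divergence sum2 !nablaE !coord_fieldE /=.
rewrite V00 V11 V0 V1 G000 G001 G110 G111.
rewrite /jV0 /jV1 /jG000 /jG001 /jG101 /jG111 /jL /jH /jq0 /jq1 /jdet0 /jdet1.
rewrite /jdet in D0 *; cbv beta; field; exact: D0.
Qed.

Lemma link_gauss y : U y -> half_plane y -> gauss_curvature g y = jK (J y).
Proof.
move=> Uy Hy; have H := HJ Uy; have HD := has_grad_jdet H; have D0 := Dn Uy.
(* The outer covariant derivative differentiates these fields, so they are identified at all nearby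
   points and not only at y. *)
have n11 z : U z -> half_plane z ->
    nabla g (@coord_field R 1) (@coord_field R 1) z 0 0 = jG011 (J z) /\
    nabla g (@coord_field R 1) (@coord_field R 1) z 0 1 = jG111 (J z).
  move=> Uz Hz; have [_ _ _ [G011 G111]] := link_christoffel Uz Hz.
  have [c0 c1] := link_pd Uz Hz (fun w _ _ => coord_fieldE 1 w 0) (has_grad_cst 0 z).
  have [c0' c1'] := link_pd Uz Hz (fun w _ _ => coord_fieldE 1 w 1) (has_grad_cst 1 z).
  rewrite !nablaE c1 c1' !coord_fieldE /= G011 G111.
  by split; ring.
have n01 z : U z -> half_plane z ->
    nabla g (@coord_field R 0) (@coord_field R 1) z 0 0 = jG001 (J z) /\
    nabla g (@coord_field R 0) (@coord_field R 1) z 0 1 = jG101 (J z).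
  move=> Uz Hz; have [_ [G001 G101] _ _] := link_christoffel Uz Hz.
  have [c0 c1] := link_pd Uz Hz (fun w _ _ => coord_fieldE 1 w 0) (has_grad_cst 0 z).
  have [c0' c1'] := link_pd Uz Hz (fun w _ _ => coord_fieldE 1 w 1) (has_grad_cst 1 z).
  rewrite !nablaE c0 c0' !coord_fieldE /= G001 G101.
  by split; ring.
have D2 : 2 * jdet (J y) != 0 by rewrite mulf_neq0.
eassert (g011 : has_grad (fun z => jG011 (J z)) y _ _).
  by rewrite /jG011; solve_grad H; exact: D2.
eassert (g111 : has_grad (fun z => jG111 (J z)) y _ _).
  by rewrite /jG111; solve_grad H; exact: D2.
eassert (g001 : has_grad (fun z => jG001 (J z)) y _ _).
  by rewrite /jG001; solve_grad H; exact: D2.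
eassert (g101 : has_grad (fun z => jG101 (J z)) y _ _).
  by rewrite /jG101; solve_grad H; exact: D2.
have [p011 _] := link_pd Uy Hy (fun z Uz Hz => (n11 z Uz Hz).1) g011.
have [p111 _] := link_pd Uy Hy (fun z Uz Hz => (n11 z Uz Hz).2) g111.
have [_ p001] := link_pd Uy Hy (fun z Uz Hz => (n01 z Uz Hz).1) g001.
have [_ p101] := link_pd Uy Hy (fun z Uz Hz => (n01 z Uz Hz).2) g101.
have [[G000 G100] [G001 G101] [G010 G110] [G011 G111]] := link_christoffel Uy Hy.
have [m011 m111] := n11 y Uy Hy; have [m001 m101] := n01 y Uy Hy.
rewrite /gauss_curvature link_det // innerE g00 // g01 // g10 // g11 //.
have E i (X : vfield R) k : nabla g (@coord_field R i) X y 0 k =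
    pd i (fun z => X z 0 k) y
    + (christoffel g k i 0 y * X y 0 0 + christoffel g k i 1 y * X y 0 1).
  by rewrite nablaE !coord_fieldE; case: (ord2_cases i) => -> /=; rewrite mul1r mul0r ?addr0 ?add0r.
have e (X Y : vfield R) k : (X \- Y) y 0 k = X y 0 k - Y y 0 k by rewrite !mxE.
have A k := E 0 (nabla g (@coord_field R 1) (@coord_field R 1)) k.
have B k := E 1 (nabla g (@coord_field R 0) (@coord_field R 1)) k.
rewrite !e !A !B p011 p111 p001 p101 m011 m111 m001 m101 !coord_fieldE /=.
rewrite G000 G100 G001 G101 G010 G110 G011 G111.
rewrite /jK /jG000 /jG100 /jG001 /jG101 /jG011 /jG111 /jdet0 /jdet1.
rewrite /jdet in D0 *; cbv beta; field; exact: D0.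
Qed.

Lemma link_dy y : U y -> half_plane y ->
  pd 0 (fun z : P => z 0 1) y = 0 /\ pd 1 (fun z : P => z 0 1) y = 1.
Proof.
move=> Uy Hy; apply: (link_pd Uy Hy (G := fun z : P => z 0 1)) => //.
apply: is_diff_eq_fun (is_diff_coord y 1) _ => v.
by rewrite /linf mulr0 mulr1 add0r.
Qed.

Lemma link_normal y : U y -> half_plane y ->
  outer_normal g y 0 0 = jsig (J y) * (jb (J y) / ja (J y)) /\
  outer_normal g y 0 1 = - jsig (J y).
Proof.
move=> Uy Hy; have D0 := Dn Uy; have A0 := an Uy.
have [i00 i01 i10 i11] := link_inv Uy Hy; have [u0 u1] := link_dy Uy Hy.
set G := grad g (fun z : P => z 0 1).
have [V0 V1] : G y 0 0 = - jb (J y) / jdet (J y) /\ G y 0 1 = ja (J y) / jdet (J y).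
  by rewrite /G /grad !mxE !sum2 !mxE u0 u1 i00 i01 i10 i11; split; ring.
(* The squared length of the gradient of coordinate 1 is the entry g^11 of the inverse metric, which
   is [jsig]^2. *)
have I : inner g G G y = ja (J y) / jdet (J y).
  rewrite innerE V0 V1 g00 // g01 // g10 // g11 //.
  by rewrite /jdet in D0 *; field.
have S0 : jsig (J y) != 0 by rewrite lt0r_neq0 // sqrtr_gt0 divr_gt0 // ?a_gt0 ?D_gt0.
have S2 : jsig (J y) * jsig (J y) = ja (J y) / jdet (J y).
  by rewrite -expr2 sqr_sqrtr // divr_ge0 // ltW // ?a_gt0 ?D_gt0.
have E k : outer_normal g y 0 k = - (jsig (J y))^-1 * G y 0 k.
  by rewrite outer_normalE normalizeE -/G I -/(jsig (J y)) mulNr.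
rewrite !E V0 V1; split; last by rewrite -S2; field.
have -> : jdet (J y) = ja (J y) / (jsig (J y) * jsig (J y)) by rewrite S2; field; rewrite A0 D0.
by field; rewrite A0 S0.
Qed.

Lemma link_normal_derivative y : U y -> half_plane y ->
  normal_derivative g f y = jnu (J y).
Proof.
move=> Uy Hy; have [u0 u1] := link_df Uy Hy; have [n0 n1] := link_normal Uy Hy.
by rewrite /normal_derivative sum2 n0 n1 u0 u1 /jnu; ring.
Qed.

Lemma link_geodesic y : U y -> half_plane y -> geodesic_curvature g y = jkap (J y).
Proof.
move=> Uy Hy; have H := HJ Uy; have HD := has_grad_jdet H; have D0 := Dn Uy; have A0 := an Uy.
have [n0 n1] := link_normal Uy Hy.
have [s0 [s1 [gs _]]] := has_grad_jsig H (a_gt0 Uy) (D_gt0 Uy).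
eassert (gn0 : has_grad (fun z => jsig (J z) * (jb (J z) / ja (J z))) y _ _).
  by solve_grad H; exact: A0.
have gn1 := has_gradN gs.
have [d0 _] := link_pd Uy Hy (fun z Uz Hz => (link_normal Uz Hz).1) gn0.
have [d1 _] := link_pd Uy Hy (fun z Uz Hz => (link_normal Uz Hz).2) gn1.
have [[G000 G100] [G001 G101] _ _] := link_christoffel Uy Hy.
have I : inner g (@coord_field R 0) (@coord_field R 0) y = ja (J y).
  rewrite innerE !coord_fieldE /= g00 // g01 // g10 // g11 //; ring.
have sa : Num.sqrt (ja (J y)) != 0 by rewrite lt0r_neq0 // sqrtr_gt0 a_gt0.
have sa2 : Num.sqrt (ja (J y)) * Num.sqrt (ja (J y)) = ja (J y).
  by rewrite -expr2 sqr_sqrtr // ltW // a_gt0.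
have t0 : unit_tangent g y 0 0 = (Num.sqrt (ja (J y)))^-1.
  by rewrite /unit_tangent normalizeE I coord_fieldE mulr1.
have t1 : unit_tangent g y 0 1 = 0.
  by rewrite /unit_tangent normalizeE I coord_fieldE mulr0.
rewrite /geodesic_curvature innerE g00 // g01 // g10 // g11 //.
rewrite t0 t1 !nablaE t0 t1 d0 d1 n0 n1 G000 G100 G001 G101 /jkap.
set S := Num.sqrt _ in sa sa2 *.
(* The unit tangent enters twice and contributes S^-2; the prefactor of [jkap] is brought to the
   same form. *)
have -> : jsig (J y) / ja (J y) = jsig (J y) / (S * S) by rewrite sa2.
rewrite /jG000 /jG100 /jG001 /jG101; cbv beta.
rewrite /jdet in D0 *; field; rewrite D0 A0 sa //.
Qed.

End Linking.

(** * Jets of smooth extensions *)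

Section JetOf.
Variable R : realType.
Notation P := 'rV[R]_2.
Implicit Types (y z v : P).

(** Mixed derivatives are taken in direction 0 first; the other orders are recovered from
    [schwarz]. *)
Definition jet_of (a b c u : P -> R) (z : P) : jet R :=
  Jet (a z) (par 0 a z) (par 1 a z) (par 0 (par 0 a) z) (par 1 (par 0 a) z) (par 1 (par 1 a) z)
      (b z) (par 0 b z) (par 1 b z) (par 0 (par 0 b) z) (par 1 (par 0 b) z) (par 1 (par 1 b) z)
      (c z) (par 0 c z) (par 1 c z) (par 0 (par 0 c) z) (par 1 (par 0 c) z) (par 1 (par 1 c) z)
      (u z) (par 0 u z) (par 1 u z) (par 0 (par 0 u) z) (par 1 (par 0 u) z) (par 1 (par 1 u) z)
      (par 0 (par 0 (par 0 u)) z) (par 1 (par 0 (par 0 u)) z)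
      (par 1 (par 1 (par 0 u)) z) (par 1 (par 1 (par 1 u)) z).

Lemma smooth_has_grad_par1 (U : set P) F y : open U -> smooth_on U F -> U y ->
  has_grad (par 1 F) y (par 1 (par 0 F) y) (par 1 (par 1 F) y).
Proof.
move=> oU sF Uy; rewrite (schwarz oU sF Uy).
exact: smooth_has_grad oU (smooth_par 1 sF) Uy.
Qed.

(** Two transpositions are needed. The one inside a further derivative must hold near y, which is
    why it is carried over by [has_grad_near]. *)
Lemma smooth_has_grad_par11 (U : set P) F y : open U -> smooth_on U F -> U y ->
  has_grad (par 1 (par 1 F)) y (par 1 (par 1 (par 0 F)) y) (par 1 (par 1 (par 1 F)) y).
Proof.
move=> oU sF Uy; have s1 := smooth_par 1 sF.
have [d d0 inU] := open_ball oU Uy.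
have h1 := smooth_has_grad oU (smooth_par 0 s1) Uy.
have h2 : has_grad (par 1 (par 0 F)) y (par 0 (par 0 (par 1 F)) y) (par 1 (par 0 (par 1 F)) y).
  by apply: has_grad_near d0 _ h1 => z /inU Uz; rewrite (schwarz oU sF Uz).
have [_ E] := has_grad_par h2.
exact: has_grad_eq (smooth_has_grad_par1 oU s1 Uy) (esym E) erefl.
Qed.

Lemma is_jet_of (U : set P) (a b c u : P -> R) y : open U -> smooth_on U a ->
  smooth_on U b -> smooth_on U c -> smooth_on U u -> U y -> is_jet (jet_of a b c u) y.
Proof.
move=> oU sa sb sc su Uy.
split.
- exact: (smooth_has_grad oU sa Uy).
- exact: (smooth_has_grad oU (smooth_par 0 sa) Uy).
- exact: (smooth_has_grad_par1 oU sa Uy).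
- exact: (smooth_has_grad oU sb Uy).
- exact: (smooth_has_grad oU (smooth_par 0 sb) Uy).
- exact: (smooth_has_grad_par1 oU sb Uy).
- exact: (smooth_has_grad oU sc Uy).
- exact: (smooth_has_grad oU (smooth_par 0 sc) Uy).
- exact: (smooth_has_grad_par1 oU sc Uy).
- exact: (smooth_has_grad oU su Uy).
- exact: (smooth_has_grad oU (smooth_par 0 su) Uy).
- exact: (smooth_has_grad_par1 oU su Uy).
- exact: (smooth_has_grad oU (smooth_par 0 (smooth_par 0 su)) Uy).
- exact: (smooth_has_grad_par1 oU (smooth_par 0 su) Uy).
- exact: (smooth_has_grad_par11 oU su Uy).
Qed.

Lemma open_pos (U : set P) F p q y : open U -> U y -> has_grad F y p q -> 0 < F y ->
  exists2 V, open V /\ V y & V `<=` U /\ forall z, V z -> 0 < F z.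
Proof.
move=> oU Uy hF F0.
have c : {for y, continuous F} by apply: differentiable_continuous; case: hF.
have /nbhs_ballP[d /= d0 hd] : nbhs y [set z | U z /\ 0 < F z].
  apply: filterI; first exact: open_nbhs_nbhs.
  exact: c (lt_nbhsr F0).
exists (ball y d); last by split=> z /hd[].
by split; [exact: ball_open|exact: ballxx].
Qed.
End JetOf.

(** * Coordinate patches *)

(** [U] is open in the plane, even around edge points, and [J] extends the data across the edge.
    Only in the half-plane does it agree with the metric [g] and the function [f]. *)
Record is_patch (R : realType) (V : set 'rV[R]_2) (g : 'rV[R]_2 -> 'M[R]_2)
    (f : 'rV[R]_2 -> R) (U : set 'rV[R]_2) (J : 'rV[R]_2 -> jet R) := IsPatch {
  pt_open : open U;
  pt_jet : forall y, U y -> is_jet J y;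
  pt_a : forall y, U y -> 0 < ja (J y);
  pt_D : forall y, U y -> 0 < jdet (J y);
  pt_u : forall y, U y -> 0 < ju (J y);
  pt_V : forall y, U y -> half_plane y -> V y;
  pt_00 : forall y, U y -> half_plane y -> g y 0 0 = ja (J y);
  pt_01 : forall y, U y -> half_plane y -> g y 0 1 = jb (J y);
  pt_10 : forall y, U y -> half_plane y -> g y 1 0 = jb (J y);
  pt_11 : forall y, U y -> half_plane y -> g y 1 1 = jc (J y);
  pt_f : forall y, U y -> half_plane y -> f y = ju (J y) }.

Section Patch.
Variable R : realType.
Notation P := 'rV[R]_2.
Implicit Types (y z v : P).

Lemma exists_patch (V U0 : set P) (g : P -> 'M[R]_2) (f : P -> R) x :
  open U0 -> V = U0 `&` @half_plane R -> V x ->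
  (forall i j, smooth_within V (fun y => g y i j)) -> smooth_within V f ->
  (forall y, V y -> (g y)^T = g y) ->
  (forall v, v != 0 -> 0 < (v *m g x *m v^T) 0 0) -> 0 < f x ->
  exists U J, is_patch V g f U J /\ U x.
Proof.
move=> oU0 VE Vx sg sf sym pos f0.
have [Ua [a [oa xa sa ga]]] := sg 0 0 x Vx.
have [Ub [b [ob xb sb gb]]] := sg 0 1 x Vx.
have [Uc [c [oc xc sc gc]]] := sg 1 1 x Vx.
have [Uu [u [ou xu su gu]]] := sf x Vx.
pose U := U0 `&` (Ua `&` Ub) `&` (Uc `&` Uu).
have U0x : U0 x by move: Vx; rewrite VE => -[].
have oU : open U by do 3?[apply: openI].
have Ux : U x by [].
pose J := jet_of a b c u.
have HJ y : U y -> is_jet J y.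
  move=> Uy; apply: (@is_jet_of R U a b c u y oU) => //.
  - by apply: smooth_sub sa => z [[_ []]].
  - by apply: smooth_sub sb => z [[_ []]].
  - by apply: smooth_sub sc => z [_ []].
  - by apply: smooth_sub su => z [_ []].
have VU y : U y -> half_plane y -> V y by move=> [[Uy _] _] Hy; rewrite VE.
have Hx : half_plane x by move: Vx; rewrite VE => -[].
have e00 y : U y -> half_plane y -> g y 0 0 = ja (J y).
  by move=> Uy Hy; have Vy := VU y Uy Hy; case: Uy => [[_ [Uy _]] _]; rewrite -ga.
have e01 y : U y -> half_plane y -> g y 0 1 = jb (J y).
  by move=> Uy Hy; have Vy := VU y Uy Hy; case: Uy => [[_ [_ Uy]] _]; rewrite -gb.
have e10 y : U y -> half_plane y -> g y 1 0 = jb (J y).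
  by move=> Uy Hy; have Vy := VU y Uy Hy; rewrite -e01 // -{1}(sym y Vy) mxE.
have e11 y : U y -> half_plane y -> g y 1 1 = jc (J y).
  by move=> Uy Hy; have Vy := VU y Uy Hy; case: Uy => [_ [Uy _]]; rewrite -gc.
have ef y : U y -> half_plane y -> f y = ju (J y).
  by move=> Uy Hy; have Vy := VU y Uy Hy; case: Uy => [_ [_ Uy]]; rewrite -gu.
have quad v : (v *m g x *m v^T) 0 0 =
    v 0 0 * v 0 0 * ja (J x) + 2 * v 0 0 * v 0 1 * jb (J x) + v 0 1 * v 0 1 * jc (J x).
  by rewrite mxE sum2 !mxE !sum2 e00 // e01 // e10 // e11 //; ring.
have a0 : 0 < ja (J x).
  have := pos (e_ 0); rewrite quad !e_E /= !(mul1r, mul0r, mulr0, addr0); apply.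
  by apply/negP => /eqP /matrixP /(_ 0 0); rewrite !mxE /=; apply/eqP; rewrite oner_eq0.
have D0 : 0 < jdet (J x).
  (* The metric takes the value a * det on this vector, so positivity gives det > 0. *)
  pose v : P := \row_i (if i == 0 then - jb (J x) else ja (J x)).
  have : 0 < ja (J x) * jdet (J x).
    have -> : ja (J x) * jdet (J x) = (v *m g x *m v^T) 0 0.
      have [v0 v1] : v 0 0 = - jb (J x) /\ v 0 1 = ja (J x) by rewrite /v !mxE.
      by rewrite quad v0 v1 /jdet; ring.
    apply: pos; apply/negP => /eqP /matrixP /(_ 0 1); rewrite !mxE /= => e.
    by move: a0; rewrite /J /= e ltxx.
  by rewrite pmulr_rgt0.
have [U1 [q1 U1x] [s1 p1]] := open_pos oU Ux (gja (HJ x Ux)) a0.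
have [U2 [q2 U2x] [s2 p2]] := open_pos q1 U1x (has_grad_jdet (HJ x Ux)) D0.
have u0 : 0 < ju (J x) by rewrite -ef.
have [U3 [q3 U3x] [s3 p3]] := open_pos q2 U2x (gju (HJ x Ux)) u0.
have sU y : U3 y -> U y by move=> /s3 /s2 /s1.
exists U3, J; split; last exact: U3x.
split; first exact: q3.
- by move=> y /sU; exact: HJ.
- by move=> y /s3 /s2; exact: p1.
- by move=> y /s3; exact: p2.
- exact: p3.
- by move=> y /sU; exact: VU.
- by move=> y /sU; exact: e00.
- by move=> y /sU; exact: e01.
- by move=> y /sU; exact: e10.
- by move=> y /sU; exact: e11.
- by move=> y /sU; exact: ef.
Qed.

Definition energy (g : P -> 'M[R]_2) (f : P -> R) y : R :=
  ((\row_j pd j f y) *m invmx (g y) *m (\row_j pd j f y)^T) 0 0.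

Lemma patch_energy V g f U J y : is_patch V g f U J -> U y -> half_plane y ->
  energy g f y = jE (J y).
Proof.
move=> [oU HJ a0 D0 _ _ h00 h01 h10 h11 hf] Uy Hy.
exact: (link_energy oU HJ D0 h00 h01 h10 h11 hf Uy Hy).
Qed.

Lemma patch_laplace V g f U J y : is_patch V g f U J -> U y -> half_plane y ->
  laplace_beltrami g f y = jL (J y) / (2 * jdet (J y) * jdet (J y)).
Proof.
move=> [oU HJ a0 D0 _ _ h00 h01 h10 h11 hf] Uy Hy.
exact: (link_laplace oU HJ D0 h00 h01 h10 h11 hf Uy Hy).
Qed.

Lemma patch_gauss V g f U J y : is_patch V g f U J -> U y -> half_plane y ->
  gauss_curvature g y = jK (J y).
Proof.
move=> [oU HJ a0 D0 _ _ h00 h01 h10 h11 hf] Uy Hy.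
exact: (link_gauss oU HJ D0 h00 h01 h10 h11 Uy Hy).
Qed.

Lemma patch_geodesic V g f U J y : is_patch V g f U J -> U y -> half_plane y ->
  geodesic_curvature g y = jkap (J y).
Proof.
move=> [oU HJ a0 D0 _ _ h00 h01 h10 h11 hf] Uy Hy.
exact: (link_geodesic oU HJ a0 D0 h00 h01 h10 h11 Uy Hy).
Qed.

Lemma patch_normal_derivative V g f U J y : is_patch V g f U J -> U y -> half_plane y ->
  normal_derivative g f y = jnu (J y).
Proof.
move=> [oU HJ a0 D0 _ _ h00 h01 h10 h11 hf] Uy Hy.
exact: (link_normal_derivative oU HJ a0 D0 h00 h01 h10 h11 hf Uy Hy).
Qed.

(** The inverse of A N A^T is A^-T N^-1 A^-1, and its outer factors cancel those of r = s A^T.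
    Invertibility of A and N comes from that of M. *)
Lemma energy_invariant (M N A : 'M[R]_2) (r s : P) : \det M != 0 ->
  M = A *m N *m A^T -> r = s *m A^T ->
  r *m invmx M *m r^T = s *m invmx N *m s^T.
Proof.
move=> M0 ME rE.
move: M0; rewrite ME !det_mulmx det_tr !mulf_eq0 !negb_or => /andP[/andP[A0 N0] _].
have uA : A \in unitmx by rewrite unitmxE unitfE.
have uN : N \in unitmx by rewrite unitmxE unitfE.
have uT : A^T \in unitmx by rewrite unitmx_tr.
have -> : invmx (A *m N *m A^T) = invmx A^T *m invmx N *m invmx A.
  have uM : A *m N *m A^T \in unitmx by rewrite !unitmx_mul uA uN uT.
  rewrite -[RHS]mulmx1 -(mulmxV uM) !mulmxA.
  rewrite -[_ *m invmx A *m A]mulmxA (mulVmx uA) mulmx1.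
  by rewrite -[_ *m invmx N *m N]mulmxA (mulVmx uN) mulmx1 (mulVmx uT) mul1mx.
by rewrite rE trmx_mul trmxK !mulmxA mulmxK // -!mulmxA mulKmx.
Qed.

(** Completing the square: a * [jN] = (a u_1 - b u_0)^2 + det * u_0^2. *)
Lemma energy_le0 (j : jet R) : 0 < ja j -> 0 < jdet j -> jE j <= 0 ->
  ju0 j = 0 /\ ju1 j = 0.
Proof.
move=> a0 D0; rewrite /jE pmulr_lle0 ?invr_gt0 // => N0.
have e : ja j * jN j = (ja j * ju1 j - jb j * ju0 j) ^+ 2 + jdet j * ju0 j ^+ 2.
  by rewrite /jN /jdet; ring.
have s0 : 0 <= (ja j * ju1 j - jb j * ju0 j) ^+ 2 by exact: sqr_ge0.
have s1 : 0 <= jdet j * ju0 j ^+ 2 by apply: mulr_ge0; [exact: ltW|exact: sqr_ge0].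
have : ja j * jN j <= 0 by rewrite pmulr_rle0.
rewrite e => h.
have /eqP : jdet j * ju0 j ^+ 2 = 0 by apply/eqP; rewrite eq_le s1 andbT; lra.
rewrite mulf_eq0 (gt_eqF D0) /= sqrf_eq0 => /eqP u0; split=> //.
have /eqP : (ja j * ju1 j - jb j * ju0 j) ^+ 2 = 0 by apply/eqP; rewrite eq_le s0 andbT; lra.
by rewrite u0 mulr0 subr0 sqrf_eq0 mulf_eq0 (gt_eqF a0) /= => /eqP.
Qed.

(** The part of a ball in the half-plane is convex, so the segment from x to y stays where the
    gradient vanishes, and [mvt_ray] applies. *)
Lemma patch_const V g f U J x : is_patch V g f U J -> U x -> half_plane x ->
  (forall y, U y -> half_plane y -> energy g f y <= 0) ->
  exists2 d, 0 < d & forall y, `|y - x| < d -> half_plane y -> U y /\ f y = f x.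
Proof.
move=> pt Ux Hx h; have [d d0 inU] := open_ball (pt_open pt) Ux.
exists d => // y yx Hy; split; first exact: inU.
have seg (t : R) : 0 <= t <= 1 -> U (x + t *: (y - x)) /\ half_plane (x + t *: (y - x)).
  move=> /andP[t0 t1]; split.
    apply: inU; rewrite addrAC subrr add0r normrZ ger0_norm //.
    by apply: le_lt_trans yx; rewrite ler_piMl.
  rewrite /half_plane /= !mxE.
  have -> : x 0 1 + t * (y 0 1 - x 0 1) = (1 - t) * x 0 1 + t * y 0 1 by ring.
  by rewrite addr_ge0 // mulr_ge0 // subr_ge0.
have [|c _ Ec] := @mvt_ray R (fun z => ju (J z)) (fun=> 0) x (y - x) 1 ltr01.
  move=> t /seg[Ut Ht]; have e := h _ Ut Ht; rewrite (patch_energy pt Ut Ht) in e.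
  have [u0 u1] := energy_le0 (pt_a pt Ut) (pt_D pt Ut) e.
  have := has_grad_derive (y - x) (gju (pt_jet pt Ut)).
  by rewrite u0 u1 /linf !mulr0 addr0.
move/eqP: Ec; rewrite mulr0 scale1r subr_eq0 addrC subrK => /eqP Ec.
by rewrite (pt_f pt) // ?(pt_f pt) //; exact: inU.
Qed.
End Patch.

(** * Change of charts and globalization *)

Section Surface.
Variables (R : realType) (T : topologicalType).
Variables (S : smooth_surface R T) (g : riemannian_metric S).
Notation P := 'rV[R]_2.
Implicit Types (c d : chart R T) (y z v : P) (o : T).
Variables (u : T -> R) (q : R).
Hypotheses (u_gt0 : forall o, 0 < u o) (u_smooth : smooth_fun S u) (q_gt0 : 0 < q).

Definition local c := u \o cinv c.

Lemma chart_mapK c o : atlas S c -> cdom c o -> cinv c (cmap c o) = o.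
Proof. by move=> /atlas_chart[_ _ h _ _]; exact: h. Qed.

Lemma chart_img c o : cdom c o -> cimg c (cmap c o).
Proof. by move=> co; exists o. Qed.

Lemma chart_half c y : atlas S c -> cimg c y -> half_plane y.
Proof. by move=> /atlas_chart[_ [U oU ->] _ _ _] []. Qed.

Lemma chart_continuous c o : atlas S c -> cdom c o -> {for o, continuous (cmap c)}.
Proof.
move=> /atlas_chart[oc _ _ cc _] co.
have := cc; rewrite continuous_open_subspace // => /(_ o); apply; exact: mem_set.
Qed.

Lemma atlas_patch c o : atlas S c -> cdom c o ->
  exists U J, is_patch (cimg c) (met g c) (local c) U J /\ U (cmap c o).
Proof.
move=> Ac co; have [_ [U oU cU] _ _ _] := atlas_chart Ac.
apply: (exists_patch oU cU (chart_img co)).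
- by move=> i j; exact: met_smooth.
- exact: u_smooth.
- by move=> y cy; exact: met_sym.
- by move=> v; apply: met_pos => //; exact: chart_img.
- exact: u_gt0.
Qed.

(** The inverse chart is continuous only relative to the chart image, so W is open in the plane but
    speaks only of its points in the half-plane. *)
Lemma overlap_nbhs c d o : atlas S c -> atlas S d -> cdom c o -> cdom d o ->
  exists2 W : set P, open W /\ W (cmap c o) & forall y, W y -> half_plane y ->
    [/\ cdom c (cinv c y), cdom d (cinv c y) & cmap c (cinv c y) = y].
Proof.
move=> Ac Ad co cdo; have [oc [U oU cU] cK _ ci] := atlas_chart Ac.
have [od _ _ _ _] := atlas_chart Ad.
have cx := chart_img co.
have n : nbhs (cinv c (cmap c o)) (cdom d).
  by rewrite (chart_mapK Ac co); exact: open_nbhs_nbhs.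
have Ux : U (cmap c o) by move: cx; rewrite cU => -[].
have h : within (cimg c) (nbhs (cmap c o)) (cinv c @^-1` cdom d).
  by rewrite nbhs_subspace_in //; exact: ci.
have : nbhs (cmap c o) [set y | U y /\ (cimg c y -> cdom d (cinv c y))].
  by apply: filterI => //; exact: open_nbhs_nbhs.
rewrite nbhsE => -[W [oW Wx] WU]; exists W => // y Wy Hy.
have [Uy dy] := WU y Wy.
have cy : cimg c y by rewrite cU.
split; [|exact: dy|].
  by case: cy => p cp <-; rewrite cK.
by case: cy => p cp <-; rewrite cK.
Qed.

(** With A the Jacobian of the transition map, the metric changes by [met_change] and du by the
    chain rule, as [energy_invariant] requires. *)
Lemma energy_change c d o : atlas S c -> atlas S d -> cdom c o -> cdom d o ->
  energy (met g c) (local c) (cmap c o) = energy (met g d) (local d) (cmap d o).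
Proof.
move=> Ac Ad co cdo.
have [W [oW Wx] hW] := overlap_nbhs Ac Ad co cdo.
have [Uc [Jc [pc Ucx]]] := atlas_patch Ac co.
have [Ud [Jd [pd_ Udx]]] := atlas_patch Ad cdo.
set x := cmap c o in Wx Ucx *.
have Hx : half_plane x by apply: (chart_half Ac); exact: chart_img.
have ox : (cmap c @` (cdom c `&` cdom d)) x by exists o.
have [U0 [T0 [oU0 U0x sT0 eT0]]] := atlas_smooth Ac Ad 0 ox.
have [U1 [T1 [oU1 U1x sT1 eT1]]] := atlas_smooth Ac Ad 1 ox.
have h0 := smooth_has_grad oU0 sT0 U0x; have h1 := smooth_has_grad oU1 sT1 U1x.
(* A smooth extension of the transition map across the edge, so that the chain rule applies on open
   sets; [pd_eq] returns to the one-sided derivatives. *)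
pose tau z : P := \row_i (if i == 0 then T0 z else T1 z).
have t0 z : tau z 0 0 = T0 z by rewrite mxE.
have t1 z : tau z 0 1 = T1 z by rewrite mxE.
have tr z j : W z -> U0 z -> U1 z -> half_plane z -> transition c d j z = tau z 0 j.
  move=> Wz U0z U1z Hz; have [cz dz cK] := hW z Wz Hz.
  have oz : (cmap c @` (cdom c `&` cdom d)) z by exists (cinv c z).
  by case: (ord2_cases j) => ->; rewrite ?t0 ?t1 ?eT0 ?eT1.
have taux : tau x = cmap d o.
  by apply: row2P; rewrite -tr // /transition /x (chart_mapK Ac co).
have hF := gju (pt_jet pd_ Udx).
have hF' : has_grad (fun z => ju (Jd z)) (tau x) (ju0 (Jd (cmap d o))) (ju1 (Jd (cmap d o))).
  by rewrite taux.
have h0' : has_grad (fun z => tau z 0 0) x (par 0 T0 x) (par 1 T0 x) by apply: has_grad_ext h0.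
have h1' : has_grad (fun z => tau z 0 1) x (par 0 T1 x) (par 1 T1 x) by apply: has_grad_ext h1.
have hcomp := has_grad_comp hF' h0' h1'.
(* V is small enough for [tau] to stay in the patch of d, where u is given by the jet [Jd]. *)
have [V [oV Vx] hV] : exists2 V, open V /\ V x & V `<=` [set z | [/\ W z, U0 z, U1 z & Ud (tau z)]].
  have Udt : Ud (tau x) by rewrite taux.
  have [e e0 he] := open_ball (pt_open pd_) Udt.
  have e2 : 0 < e / 2 by rewrite divr_gt0.
  have near_T F p r : has_grad F x p r -> nbhs x [set z | `|F x - F z| <= e / 2].
    by case=> /differentiable_continuous /cvgrPdist_le + _; apply.
  have : nbhs x [set z | [/\ W z, U0 z, U1 z & Ud (tau z)]].
    near=> z; split.
    - by near: z; exact: open_nbhs_nbhs.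
    - by near: z; exact: open_nbhs_nbhs.
    - by near: z; exact: open_nbhs_nbhs.
    - apply: he; apply: (@le_lt_trans _ _ (e / 2)); last by rewrite ltr_pdivrMr // ltr_pMr // ltr1n.
      rewrite (norm_row2_le _ (ltW e2)) !mxE /=; apply/andP; split; rewrite distrC; near: z.
        exact: near_T h0.
      exact: near_T h1.
  by rewrite nbhsE => -[V [oV Vx] VU]; exists V.
have lc z : V z -> half_plane z -> local c z = ju (Jd (tau z)).
  move=> /hV[Wz U0z U1z Uz] Hz; have [cz dz cK] := hW z Wz Hz.
  have tz : tau z = cmap d (cinv c z) by apply: row2P; rewrite -tr.
  rewrite -(pt_f pd_ Uz) tz /local /= ?(chart_mapK Ad dz) //.
  by apply: (chart_half Ad); exact: chart_img.
have ptr j z : V z -> half_plane z -> transition c d j z = tau z 0 j.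
  by move=> /hV[Wz U0z U1z Uz] Hz; exact: tr.
have dj i : pd i (local d) (cmap d o) = (if i == 0 then ju0 (Jd (cmap d o)) else ju1 (Jd (cmap d o))).
  apply: (pd_eq i (pt_open pd_) Udx _ (pt_f pd_) hF).
  by apply: (chart_half Ad); exact: chart_img.
have := met_change g Ac Ad co cdo; set A := \matrix_(i, j) _ => /= has_grad_jE.
have AE : [/\ A 0 0 = par 0 T0 x, A 1 0 = par 1 T0 x, A 0 1 = par 0 T1 x & A 1 1 = par 1 T1 x].
  by split; rewrite /A !mxE; [rewrite (pd_eq 0 oV Vx Hx (ptr 0) h0')
   |rewrite (pd_eq 1 oV Vx Hx (ptr 0) h0')|rewrite (pd_eq 0 oV Vx Hx (ptr 1) h1')
   |rewrite (pd_eq 1 oV Vx Hx (ptr 1) h1')].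
have [A00 A10 A01 A11] := AE.
have D0 : \det (met g c x) != 0.
  rewrite (link_det (pt_00 pc) (pt_01 pc) (pt_10 pc) (pt_11 pc)) //.
  by rewrite gt_eqF // (pt_D pc).
have lE k : (\row_j pd j (local d) (cmap d o) *m A^T) 0 k =
   pd 0 (local d) (cmap d o) * A k 0 + pd 1 (local d) (cmap d o) * A k 1.
  by rewrite mxE sum2 !mxE.
have rE k : (\row_j pd j (local c) x) 0 k = pd k (local c) x by rewrite mxE.
have rsE : \row_j pd j (local c) x = \row_j pd j (local d) (cmap d o) *m A^T.
  apply: row2P; rewrite lE rE !dj //= ?A00 ?A10 ?A01 ?A11 (pd_eq _ oV Vx Hx lc hcomp) /=; ring.
by rewrite /energy (energy_invariant D0 has_grad_jE rsE).
Unshelve. all: by end_near.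
Qed.

(** * The function phi on the whole surface *)

Let chart_at o : chart R T := projT1 (cid2 (atlas_cover S o)).

Let chart_atP o : atlas S (chart_at o) /\ cdom (chart_at o) o.
Proof. by rewrite /chart_at; case: (cid2 _). Qed.

(** Read in a chosen chart around o; [PhiE] shows that the choice does not matter. *)
Definition Phi o : R :=
  energy (met g (chart_at o)) (local (chart_at o)) (cmap (chart_at o) o) / powR (u o) q.

Lemma PhiE c o : atlas S c -> cdom c o ->
  Phi o = energy (met g c) (local c) (cmap c o) / powR (u o) q.
Proof.
move=> Ac co; have [Ad cdo] := chart_atP o.
by rewrite /Phi (energy_change Ad Ac cdo co).
Qed.

Lemma Phi_patch c U J o : atlas S c -> cdom c o ->
  is_patch (cimg c) (met g c) (local c) U J -> U (cmap c o) ->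
  Phi o = phi q (J (cmap c o)).
Proof.
move=> Ac co pt Uo; have Ho := chart_half Ac (chart_img co).
rewrite (PhiE Ac co) (patch_energy pt Uo Ho) /phi -(pt_f pt Uo Ho).
by rewrite /local /= (chart_mapK Ac co).
Qed.

Lemma chart_near c o (A : set P) : atlas S c -> cdom c o -> nbhs (cmap c o) A ->
  \forall w \near o, cdom c w /\ A (cmap c w).
Proof.
move=> Ac co nA; apply: filterI; last exact: chart_continuous Ac co _ nA.
by apply: open_nbhs_nbhs; split=> //; case: (atlas_chart Ac).
Qed.

Lemma Phi_continuous : continuous Phi.
Proof.
move=> o; have [Ac co] := chart_atP o; set c := chart_at o in Ac co.
have [U [J [pt Uo]]] := atlas_patch Ac co.
have cphi : {for cmap c o, continuous (fun z => phi q (J z))}.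
  apply: differentiable_continuous.
  have D0 : jdet (J (cmap c o)) != 0 by rewrite gt_eqF // (pt_D pt).
  by case: (has_grad_phi (pt_jet pt Uo) D0 q_gt0 (pt_u pt Uo)).
move=> B; rewrite (Phi_patch Ac co pt Uo) => /cphi nB.
have : nbhs (cmap c o) ([set z | B (phi q (J z))] `&` U).
  by apply: filterI => //; apply: open_nbhs_nbhs; split=> //; exact: pt_open pt.
move=> /(chart_near Ac co); apply: filterS => w [co' [Bo' Uo']] /=.
by rewrite (Phi_patch Ac co' pt Uo').
Qed.

Lemma locally_constant : (forall o, Phi o <= 0) -> forall o, \forall w \near o, u w = u o.
Proof.
move=> Phi0 o; have [Ac co] := chart_atP o; set c := chart_at o in Ac co.
have [U [J [pt Uo]]] := atlas_patch Ac co.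
have Ho := chart_half Ac (chart_img co).
have [|e e0 he] := patch_const pt Uo Ho.
  move=> y Uy Hy; have [w co' ye] := pt_V pt Uy Hy.
  have := Phi0 w; rewrite (PhiE Ac co') ye pmulr_lle0 // invr_gt0.
  by rewrite powR_gt0.
have : nbhs (cmap c o) (ball (cmap c o) e) by exact: nbhsx_ballx.
move=> /(chart_near Ac co); apply: filterS => w [co'].
rewrite -ball_normE /= distrC => /he h.
have [_] := h (chart_half Ac (chart_img co')).
by rewrite /local /= !chart_mapK.
Qed.

(** Local constancy makes the preimage under u of any set open, so the level set of u o is open and
    closed. *)
Lemma globally_constant : connected [set: T] -> (forall o, Phi o <= 0) ->
  forall o w, u w = u o.
Proof.
move=> cT Phi0 o w.
have op (B : set R) : open [set p | B (u p)].
  rewrite openE => p Bp; have := locally_constant Phi0 p.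
  by apply: filterS => p' /= ->.
have H : [set p | u p = u o] = setT.
  apply: cT.
  - by exists o.
  - by exists [set p | u p = u o]; [exact: (op [set r | r = u o])|rewrite setTI].
  - exists [set p | u p = u o]; last by rewrite setTI.
    rewrite -openC; exact: (op [set r | ~ (r = u o)]).
- by move: (I : [set: T] w) => h; have : [set p | u p = u o] w by rewrite H.
Qed.
End Surface.

Unset Implicit Arguments.
Set Strict Implicit.
Set Printing Implicit Defensive.

Theorem theorem4 (R : realType) (T : topologicalType)
    (S : smooth_surface R T) (g : riemannian_metric S)
    (T_compact : compact [set: T]) (T_connected : connected [set: T])
    (boundary_nonempty : surface_boundary S !=set0)
    (K_ge0 : forall (c : chart R T) (p : T), atlas S c -> cdom c p ->
      0 <= gauss_curvature (met g c) (cmap c p))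
    (kappa_ge1 : forall (c : chart R T) (p : T), atlas S c -> cdom c p ->
      surface_boundary S p ->
      1 <= geodesic_curvature (met g c) (cmap c p))
    (lambda q : R) (lambda_gt0 : 0 < lambda) (q_ge2 : 2 <= q)
    (u : T -> R) (u_gt0 : forall p : T, 0 < u p) (u_smooth : smooth_fun S u)
    (u_harmonic : forall (c : chart R T) (p : T), atlas S c -> cdom c p ->
      laplace_beltrami (met g c) (u \o cinv c) (cmap c p) = 0)
    (u_boundary : forall (c : chart R T) (p : T), atlas S c -> cdom c p ->
      surface_boundary S p ->
      normal_derivative (met g c) (u \o cinv c) (cmap c p) + lambda * u p
      = powR (u p) q)
    (lambda_le : lambda <= 1 / (q - 1)) :
  exists a : R, forall p : T, u p = a.
Proof.
have q_gt0 : 0 < q by apply: lt_le_trans q_ge2; rewrite ltr0n.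
have [p0 _] := boundary_nonempty; exists (u p0).
apply: (globally_constant (g := g) (q := q) u_gt0 u_smooth T_connected) => w.
have T0 : [set: T] !=set0 by exists p0.
have [|p _ p_max] := compact_EVT_max (f := Phi g u q) T0 T_compact.
  by apply: continuous_subspaceT; exact: Phi_continuous.
(* It remains to show Phi <= 0 at one maximum point p, where [local_max] applies in a patch. *)
apply: le_trans (p_max w (mem_setT w)) _.
have [c Ac cp] := atlas_cover S p.
have [U [J [pt Up]]] := atlas_patch g u_gt0 u_smooth Ac cp.
have [oU HJ a_gt0 D_gt0 ju_gt0 UV _ _ _ _ fu] := pt.
have Hx := chart_half Ac (chart_img cp).
rewrite (Phi_patch q u_gt0 u_smooth Ac cp pt Up) /phi.
rewrite pmulr_lle0; last by rewrite invr_gt0 powR_gt0 // ju_gt0.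
apply: (local_max oU Up Hx HJ a_gt0 D_gt0 ju_gt0 lambda_gt0 q_ge2 lambda_le).
- move=> y Uy Hy; have [v cv yE] := UV y Uy Hy.
  have := u_harmonic c v Ac cv; rewrite yE (patch_laplace pt Uy Hy).
  move/eqP; rewrite mulf_eq0 invr_eq0 => /orP[/eqP //|].
  by rewrite !mulf_eq0 (gt_eqF (D_gt0 y Uy)) pnatr_eq0.
- by have := K_ge0 c p Ac cp; rewrite (patch_gauss pt Up Hx).
- move=> x1; split.
    have bp : surface_boundary S p by exists c.
    by have := kappa_ge1 c p Ac cp bp; rewrite (patch_geodesic pt Up Hx).
  move=> y Uy y1; have Hy : half_plane y by rewrite /half_plane /= y1.
  have [v cv yE] := UV y Uy Hy.
  (* Edge points of the patch are boundary points, with the chart [c] itself as witness. *)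
  have bv : surface_boundary S v by exists c; rewrite yE.
  have := u_boundary c v Ac cv bv; rewrite yE (patch_normal_derivative pt Uy Hy).
  by rewrite -(fu y Uy Hy) /local /= -yE (chart_mapK Ac cv).
- move=> y Uy Hy; have [v cv yE] := UV y Uy Hy.
  have := p_max v (mem_setT v).
  rewrite (Phi_patch q u_gt0 u_smooth Ac cp pt Up).
  by rewrite (Phi_patch q u_gt0 u_smooth Ac cv pt) yE.
Qed.
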